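(* A prime number theorem does not hold in general in the class of minimal almost 1-1 symbolic extensions of odometers satisfying $\lim_{t\to\infty}\delta(E^t)/n_t=0$. That is, there exist a finite alphabet $\mathcal{A}$ and a regular Toeplitz sequence $x\in\mathcal{A}^{\mathbb{Z}}$ such that the (strictly ergodic) subshift $(X_x,S)$ does not satisfy a PNT.
   Context: A topological dynamical system $(X,T)$ ($T$ a homeomorphism of a compact metric space $X$) satisfies a prime number theorem (PNT) if for every $y\in X$ and every $f\in C(X)$ the limit $\lim_{N\to\infty}\frac{1}{\pi(N)}\sum_{p<N}f(T^py)$ exists, where $p$ runs over primes and $\pi(N)$ is the number of primes up to $N$. $S$ denotes the left shift on $\mathcal{A}^{\mathbb{Z}}$, $\mathcal{A}$ finite. A sequence $x\in\mathcal{A}^{\mathbb{Z}}$ is Toeplitz if for every $a\in\mathbb{Z}$ there is $\ell\in\mathbb{N}$, $\ell\ge1$, with $x(a)=x(a+k\ell)$ for all $k\in\mathbb{Z}$. $X_x$ is the orbit closure of $x$ under $S$ (all $y\in\mathcal{A}^{\mathbb{Z}}$ all of whose finite subblocks appear in $x$). Let $\mathrm{Per}_{n}(x)=\{a\in\mathbb{Z}: x(a)=x(a+kn)\text{ for all }k\in\mathbb{Z}\}$. For a Toeplitz sequence there is a sequence $n_t\mid n_{t+1}$ (a periodic structure) with $\bigcup_t\mathrm{Per}_{n_t}(x)=\mathbb{Z}$, and a natural continuous equivariant surjection $\pi:X_x\to H$ onto the odometer $H=\varprojlim\mathbb{Z}/n_t\mathbb{Z}$ (with the translation by $(1,1,\ldots)$).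 $x$ is regular if the density of $\mathrm{Per}_{n_t}(x)$ tends to $1$ as $t\to\infty$. Minimal almost 1-1 symbolic extensions of odometers (i.e. minimal subshifts with a continuous equivariant surjection onto an odometer having at least one singleton fiber) are exactly the Toeplitz subshifts $(X_x,S)$. With $D^t_j=\{h\in H: h_t=j\}$, put $E^t_j=\pi^{-1}(D^t_j)$ for $0\le j<n_t$, and $\delta(E^t)=\sum_{0\le j<n_t}\operatorname{diam}(E^t_j)$, the diameter being taken in the metric $d(y,z)=2^{-\inf\{|n|:y(n)\ne z(n)\}}$ (with $d(y,y)=0$). Regularity of $x$ is equivalent to $\lim_{t\to\infty}\delta(E^t)/n_t=0$. *)

(* Defs.v *)
From HB Require Import structures.
From mathcomp Require Import all_boot all_order all_algebra.
From mathcomp Require Import all_classical all_reals all_analysis.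

Set Implicit Arguments.
Unset Strict Implicit.
Unset Printing Implicit Defensive.

Import Order.TTheory GRing.Theory Num.Theory.
Import numFieldNormedType.Exports.

Local Open Scope classical_set_scope.
Local Open Scope ring_scope.

(* The point only serves to give [fullshift] the [pointedType] structure that
   the library requires of a measurable space; an alphabet carrying a
   bi-infinite sequence is nonempty anyway. *)
#[short(type="finPointedType")]
HB.structure Definition FinPointed := {A of Finite A & Pointed A}.

Section dynamics.
Variable R : realType.

Definition prime_count (N : nat) : nat := (\sum_(p < N.+1 | prime p) 1)%N.

(* A system is a set [K] of an ambient space with a self-map [T] of that space.
   Only real-valued test functions are used: a complex-valued one has
   convergent averages iff its real and imaginary parts do. *)
Definition satisfies_PNT (X : topologicalType) (K : set X) (T : X -> X) :=
  forall (y : X) (f : X -> R), K y -> {within K, continuous f} ->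
    cvg ((\sum_(0 <= p < N | prime p) f (iter p T y)) / (prime_count N)%:R
           @[N --> \oo]).

Definition minimal_system (X : topologicalType) (K : set X) (T : X -> X) :=
  [/\ K !=set0, closed K, T @` K = K &
    forall Y : set X, Y !=set0 -> closed Y -> Y `<=` K -> T @` Y = Y -> Y = K].

Definition borel (X : ptopologicalType) := g_sigma_algebraType (@open X).

(* Probabilities on [K] are encoded as Borel probabilities on the ambient space
   giving mass 1 to [K]; this is meant for closed [K] only. *)
Definition invariant_probability (X : ptopologicalType) (K : set X)
    (T : X -> X) (mu : probability (borel X) R) :=
  mu K = 1%E /\
  forall B : set (borel X), measurable B -> mu (T @^-1` B) = mu B.

Definition uniquely_ergodic (X : ptopologicalType) (K : set X) (T : X -> X) :=
  exists2 mu : probability (borel X) R, invariant_probability K T mu &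
    forall nu : probability (borel X) R, invariant_probability K T nu ->
      forall B : set (borel X), measurable B -> nu B = mu B.

Definition strictly_ergodic (X : ptopologicalType) (K : set X) (T : X -> X) :=
  minimal_system K T /\ uniquely_ergodic K T.

(* Two-sided asymptotic density; [lim] is a junk value when the limit does not
   exist, which cannot happen for the periodic sets it is applied to. *)
Definition density (D : set int) : R :=
  lim (((\sum_(i < N.*2.+1) \1_D (i%:Z - N%:Z)) / N.*2.+1%:R : R) @[N --> \oo]).

End dynamics.

Section symbolic.
Variable A : finPointedType.

Definition fullshift : Type := prod_topology (fun _ : int => discrete_topology A).

HB.instance Definition _ := Pointed.on fullshift.
HB.instance Definition _ := Topological.on fullshift.

Definition left_shift (y : fullshift) : fullshift := fun a => y (a + 1).

Definition shiftz (k : int) (y : fullshift) : fullshift := fun a => y (a + k).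

Definition orbit_closure (x : fullshift) : set fullshift :=
  closure [set shiftz k x | k in [set: int]].

(* This metric induces the product topology of [fullshift]. *)
Definition shift_dist (R : realType) (y z : fullshift) : R :=
  if y == z then 0
  else 2 `^ (- inf [set `|a|%:~R | a in [set a : int | y a != z a]]).

Definition diam (R : realType) (E : set fullshift) : R :=
  sup [set shift_dist R yz.1 yz.2 | yz in E `*` E].

Definition toeplitz (x : fullshift) :=
  forall a : int, exists l : nat, (0 < l)%N /\
    forall k : int, x a = x (a + k * l%:Z).

Definition Per (x : fullshift) (n : nat) : set int :=
  [set a : int | forall k : int, x a = x (a + k * n%:Z)].

Definition periodic_structure (x : fullshift) (n : nat -> nat) :=
  [/\ forall t, (0 < n t)%N, forall t, (n t %| n t.+1)%N &
      \bigcup_t Per x (n t) = [set: int]].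

Definition regular_toeplitz (R : realType) (x : fullshift) (n : nat -> nat) :=
  density R (Per x (n t)) @[t --> \oo] --> (1 : R).

End symbolic.

Section odometers.
Variable n : nat -> nat.

(* The element (h_t)_t of the inverse limit of the Z/(n_t)Z is encoded by the
   representatives 0 <= h_t < n_t; the topology is that of {ptws nat -> nat},
   with nat discrete. *)
Definition odometer : set {ptws nat -> nat} :=
  [set h : {ptws nat -> nat} |
    forall t, (h t < n t)%N /\ (h t.+1 = h t %[mod n t])].

Definition odometer_rot (h : {ptws nat -> nat}) : {ptws nat -> nat} :=
  fun t => ((h t).+1 %% n t)%N.

Variable A : finPointedType.

Definition factor_map (K : set (fullshift A))
    (f : fullshift A -> {ptws nat -> nat}) :=
  [/\ {within K, continuous f}, f @` K = odometer &
      forall y, K y -> f (left_shift y) = odometer_rot (f y)].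

Definition almost_1_1 (K : set (fullshift A))
    (f : fullshift A -> {ptws nat -> nat}) :=
  exists2 h, odometer h & exists y, K `&` f @^-1` [set h] = [set y].

Definition tower_level (K : set (fullshift A))
    (f : fullshift A -> {ptws nat -> nat}) (t j : nat) : set (fullshift A) :=
  K `&` f @^-1` [set h : {ptws nat -> nat} | odometer h /\ h t = j].

Definition tower_delta (R : realType) (K : set (fullshift A))
    (f : fullshift A -> {ptws nat -> nat}) (t : nat) : R :=
  \sum_(0 <= j < n t) diam R (tower_level K f t j).

End odometers.

(* Main.v *)
(* The least prime dividing an integer determines its letter: enumerate the
   primes as p_0 < p_1 < ..., choose residues r_i hitting every integer, and
   let x(a) = g(i) for the least i such that p_i divides a - r_i.  This is
   Toeplitz along n_t = p_0 ... p_(t-1), and it is regular because the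
   positions not filled at stage t have density
   (1 - 1/p_0) ... (1 - 1/p_(t-1)) --> 0.  A point y of the orbit closure with
   odometer coordinate (r_i)_i has y(p_m) = g(m), since the only prime dividing
   p_m is p_m itself.  As g is arbitrary, its averages over the primes can be
   made to oscillate; no information on the distribution of primes is needed. *)
Require Import Defs.
From HB Require Import structures.
From mathcomp Require Import all_boot all_order all_algebra.
From mathcomp Require Import all_classical all_reals all_analysis.
From mathcomp Require Import zify ring lra.
Set Implicit Arguments.
Unset Strict Implicit.
Unset Printing Implicit Defensive.
Import Order.TTheory GRing.Theory Num.Theory.
Import numFieldNormedType.Exports.
Local Open Scope classical_set_scope.
Local Open Scope ring_scope.

(** * Windows and the product topology *)

(** The delicate object is the factor map onto the odometer, not the oscillation. To define it, a
    finite window of a shift of [x] must reveal the shift modulo [n t]; a constant [g] would reveal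
    nothing. Hence the condition that every letter [g i] is followed by a different one later on,
    which the oscillating [g] also satisfies. Once residues are readable from windows, each odometer
    coordinate is locally constant. The remaining dynamics is governed by one quantity, the
    proportion of positions not filled at stage [t]. A tower level whose window avoids these
    positions shows a single block, so it is narrow and every invariant probability treats it alike;
    the other levels are few. This yields both the vanishing of the normalized diameters and unique
    ergodicity. That the product of the factors 1 - 1/p tends to 0 is obtained without infinite
    products: restricted to the first N primes, it is at most the inverse of the N-th harmonic
    sum. *)

Section window_topology.
Variable A : finPointedType.
Implicit Types (x y z : fullshift A) (M : nat) (a k : int).

Definition agree M y z := forall a, (`|a| <= M)%N -> y a = z a.

Lemma agree_refl M y : agree M y y. Proof. by []. Qed.

Lemma agree_sym M y z : agree M y z -> agree M z y.
Proof. by move=> h a /h. Qed.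

Lemma agree_trans M y z w : agree M y z -> agree M z w -> agree M y w.
Proof. by move=> h h' a aM; rewrite h // h'. Qed.

Lemma agreeW M N y z : (N <= M)%N -> agree M y z -> agree N y z.
Proof. by move=> NM h a aN; apply: h; exact: leq_trans NM. Qed.

Lemma agree_shiftz M y z k :
  agree (M + `|k|) y z -> agree M (shiftz k y) (shiftz k z).
Proof. by move=> h a aM; rewrite /shiftz; apply: h; lia. Qed.

Lemma shiftzD k l y : shiftz k (shiftz l y) = shiftz (k + l) y.
Proof. by apply/funext => a; rewrite /shiftz addrA. Qed.

Lemma shiftz0 y : shiftz 0 y = y.
Proof. by apply/funext => a; rewrite /shiftz addr0. Qed.

Lemma left_shiftE : @left_shift A = shiftz 1. Proof. by []. Qed.

Lemma iter_left_shift m y : iter m (@left_shift A) y = shiftz m%:Z y.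
Proof.
elim: m => [|m IH]; first by rewrite shiftz0.
by rewrite iterS IH left_shiftE shiftzD; congr (shiftz _ _); lia.
Qed.

Lemma nbhs_coord y a : nbhs y [set z : fullshift A | z a = y a].
Proof.
have h : nbhs (y a : discrete_topology A) [set y a] by exact: discrete_set1.
exact: (@proj_continuous int (fun=> discrete_topology A) a y [set y a] h).
Qed.

(** A window imposes finitely many conditions on coordinates in a discrete alphabet, hence is a
    neighbourhood. Conversely, the sets containing a window around [y] form a filter, and it
    converges to [y] in the product because it does so in each coordinate. *)
Lemma nbhs_agree y (U : set (fullshift A)) :
  nbhs y U <-> exists M, forall z, agree M y z -> U z.
Proof.
split; last first.
  move=> [M yU].
  pose f (i : 'I_M.+1) : set (fullshift A) :=
    [set z : fullshift A | z (i : nat)%:Z = y (i : nat)%:Z] `&`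
    [set z : fullshift A | z (- (i : nat)%:Z) = y (- (i : nat)%:Z)].
  have h : nbhs y [set z : fullshift A | forall i, f i z].
    apply: (@filter_forall _ _ f (nbhs y) (nbhs_filter y) _) => i.
    by apply: filterI; exact: nbhs_coord.
  apply: filterS h => z h; apply: yU => a aM.
  have iM : (`|a| < M.+1)%N by lia.
  have [/= h1 h2] := h (Ordinal iM).
  have [a0|a0] := leP 0 a; first by rewrite -(gez0_abs a0) h1.
  by rewrite -[a]opprK -(ltz0_abs a0) h2.
pose F : set_system (fullshift A) :=
  [set V | exists M, forall z, agree M y z -> V z].
have FF : Filter F.
  split.
  - by exists 0%N.
  - move=> P Q [M PM] [N QN]; exists (maxn M N) => z yz; split.
      by apply: PM; apply: agreeW yz; exact: leq_maxl.
    by apply: QN; apply: agreeW yz; exact: leq_maxr.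
  - by move=> P Q PQ [M PM]; exists M => z /PM /PQ.
suff : F --> y by apply.
apply/cvg_sup => a V [B [[C oC <-] /= By] BV].
by exists `|a|%N => z yz; apply: BV; rewrite /preimage/= -yz.
Qed.

Lemma compact_fullshift : compact [set: fullshift A].
Proof.
have fin (i : int) : compact [set: discrete_topology A].
  by apply: finite_compact; exact: (@finite_finset A setT).
have h := @tychonoff int (fun=> discrete_topology A) (fun=> setT) fin.
rewrite (_ : [set: fullshift A] = [set f | forall i, setT (f i)]) //.
by apply/seteqP; split.
Qed.

End window_topology.

(** * Orbit closures of Toeplitz sequences *)

Section orbit_closures.
Variables (A : finPointedType) (x : fullshift A).
Implicit Types (y z : fullshift A) (M : nat) (a k : int).
Local Notation K := (orbit_closure x).

Lemma orbit_closureP y : K y <-> forall M, exists k, agree M y (shiftz k x).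
Proof.
split=> [Ky M|h U].
  have yM : nbhs y [set z : fullshift A | agree M y z].
    by apply/nbhs_agree; exists M.
  by have [_ [[k _ <-] ?]] := Ky _ yM; exists k.
move=> /nbhs_agree[M yU]; have [k yk] := h M.
by exists (shiftz k x); split; [exists k | exact: yU].
Qed.

Lemma orbit_closure_shiftz k : K (shiftz k x).
Proof. by apply/orbit_closureP => M; exists k; exact: agree_refl. Qed.

Lemma orbit_closure_base : K x.
Proof. by rewrite -[x in K x]shiftz0; exact: orbit_closure_shiftz. Qed.

Lemma shiftz_orbit_closure y k : K y -> K (shiftz k y).
Proof.
move=> /orbit_closureP h; apply/orbit_closureP => M.
have [l yl] := h (M + `|k|)%N; exists (k + l).
by rewrite -shiftzD; exact: agree_shiftz.
Qed.

Lemma closed_orbit_closure : closed K.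
Proof. exact: closed_closure. Qed.

Lemma left_shift_orbit_closure : @left_shift A @` K = K.
Proof.
apply/seteqP; split=> [_ [y Ky <-]|y Ky].
  by rewrite left_shiftE; exact: shiftz_orbit_closure.
exists (shiftz (-1) y); first exact: shiftz_orbit_closure.
by rewrite left_shiftE shiftzD subrr shiftz0.
Qed.

(** Compactness in sequential form. It produces the points that are prescribed by congruences: the
    preimage of an odometer element, and the point whose averages over the primes diverge. *)
Lemma orbit_closure_cluster (u : nat -> fullshift A) : (forall s, K (u s)) ->
  exists2 y, K y & forall M N, exists2 s, (N <= s)%N & agree M y (u s).
Proof.
move=> Ku; have [y [_ clu]] := @compact_fullshift A (u @ \oo) _ filterT.
have uy M N : exists2 s, (N <= s)%N & agree M y (u s).
  have tl : (u @ \oo) (u @` [set s | (N <= s)%N]).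
    by exists N => // s /= Ns; exists s.
  have yM : nbhs y [set z : fullshift A | agree M y z].
    by apply/nbhs_agree; exists M.
  by have [_ [[s /= Ns <-] ?]] := clu _ _ tl yM; exists s.
exists y => //; apply/orbit_closureP => M.
have [s _ ys] := uy M 0%N; have /orbit_closureP/(_ M)[k sk] := Ku s.
by exists k; exact: agree_trans ys sk.
Qed.

End orbit_closures.

(** * Minimality of Toeplitz subshifts *)

Section toeplitz_subshift.
Variables (A : finPointedType) (x : fullshift A) (n : nat -> nat).
Hypothesis xn : periodic_structure x n.
Implicit Types (y z : fullshift A) (M t : nat) (a k : int).
Local Notation K := (orbit_closure x).

Let n_gt0 t : (0 < n t)%N. Proof. by case: xn. Qed.

Lemma periodic_structure_dvdn s t : (s <= t)%N -> (n s %| n t)%N.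
Proof.
elim: t => [|t IH]; first by rewrite leqn0 => /eqP->.
rewrite leq_eqVlt => /orP[/eqP->//|/IH st]; apply: dvdn_trans st _.
by case: xn.
Qed.

Lemma PerP m a : Per x m a <-> forall b, (b = a %[mod m%:Z])%Z -> x b = x a.
Proof.
split=> [h b /eqP|h k]; last by rewrite (h (a + k * m%:Z)) // addrC modzMDl.
rewrite eqz_mod_dvd => /dvdzP[k e].
by rewrite (h k) -e addrC subrK.
Qed.

Lemma Per_dvdn l m a : (l %| m)%N -> Per x l a -> Per x m a.
Proof.
move=> lm /PerP h; apply/PerP => b /eqP; rewrite eqz_mod_dvd => e.
apply: h; apply/eqP; rewrite eqz_mod_dvd; apply: dvdz_trans e.
by rewrite dvdzE /=.
Qed.

Lemma Per_window M :
  exists t, forall a, (`|a| <= M)%N -> Per x (n t) a.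
Proof.
have cov a : exists t, Per x (n t) a.
  have [_ _ e] := xn; have [t _ ?] : (\bigcup_t Per x (n t)) a by rewrite e.
  by exists t.
pose f a := xget 0%N [set t | Per x (n t) a].
have Pf a : Per x (n (f a)) a.
  exact: (xgetPex 0%N (cov a)).
exists (\max_(i < M.+1) maxn (f (i : nat)%:Z) (f (- (i : nat)%:Z)))%N => a aM.
apply: Per_dvdn (Pf a); apply: periodic_structure_dvdn.
have iM : (`|a| < M.+1)%N by lia.
apply: leq_trans (leq_bigmax (Ordinal iM)) => /=.
have [a0|a0] := leP 0 a; first by rewrite (gez0_abs a0) leq_maxl.
by rewrite (ltz0_abs a0) opprK leq_maxr.
Qed.

Lemma Per_agree M t j k : (forall a, (`|a| <= M)%N -> Per x (n t) (a + j)) ->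
  (k = j %[mod n t])%Z -> agree M (shiftz k x) (shiftz j x).
Proof.
move=> h kj a /h /PerP; apply.
by rewrite -modzDmr kj modzDmr.
Qed.

(** The central block of [x] of radius [M] recurs with period [n t] for some [t], so every point of
    the orbit closure shows it after a shift by less than [n t]. Hence [x] lies in every nonempty
    closed invariant subset. *)
Lemma orbit_closure_minimal : minimal_system K (@left_shift A).
Proof.
split; [by exists x; exact: orbit_closure_base |exact: closed_orbit_closure
       |exact: left_shift_orbit_closure |].
move=> Y [y Yy] Ycl YK YS; apply/seteqP; split=> // z.
have shY w : Y w -> Y (shiftz 1 w) by move=> Yw; rewrite -YS; exists w.
have shY' w : Y w -> Y (shiftz (-1) w).
  rewrite -{1}YS => -[v Yv <-]; rewrite left_shiftE shiftzD.
  by rewrite (_ : -1 + 1 = 0 :> int) ?shiftz0.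
have shiftY k w : Y w -> Y (shiftz k w).
  move=> Yw; elim/int_rec: k => [|k IH|k IH]; first by rewrite shiftz0.
    by have := shY _ IH; rewrite shiftzD; congr (Y (shiftz _ _)); lia.
  have := shY' _ IH; rewrite shiftzD (_ : -1 - k%:Z = - k.+1%:Z)//; lia.
suff Yx : Y x.
  move=> Kz; rewrite ((closure_id Y).1 Ycl) => U Uz.
  have [_ [[k _ <-] ?]] := Kz _ Uz.
  by exists (shiftz k x); split => //; exact: shiftY.
rewrite ((closure_id Y).1 Ycl) => U /nbhs_agree[M xU].
have [t tM] := Per_window M.
have /orbit_closureP/(_ (M + n t)%N)[k yk] := YK _ Yy.
(* [l + k] is a multiple of [n t], and 0 <= [l] < [n t] keeps the shifted window inside the radius
   [M + n t] on which [y] is known. *)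
pose l := (- k %% n t)%Z.
exists (shiftz l y); split; first exact: shiftY.
apply: xU; apply: (@agree_trans _ _ _ (shiftz (l + k) x)).
  rewrite -[x in agree _ x]shiftz0; apply: agree_sym.
  apply: (@Per_agree _ t); first by move=> a /tM; rewrite addr0.
  by rewrite modzDml addNr.
rewrite -shiftzD; apply: agree_shiftz; apply: agree_sym.
apply: agreeW yk; rewrite leq_add2l.
have : l < n t by apply: ltz_pmod; exact: n_gt0.
have : 0 <= l by apply: modz_ge0; have := n_gt0 t; lia.
lia.
Qed.

End toeplitz_subshift.

(** * The odometer factor *)

Lemma modz_dvdn (m : int) (d e : nat) :
  (d %| e)%N -> ((m %% e)%Z = m %[mod d])%Z.
Proof.
move=> de; apply/eqP; rewrite eqz_mod_dvd {2}(divz_eq m e) opprD addrC subrK.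
by rewrite dvdzE abszN abszM dvdn_mull.
Qed.

Lemma ptws_nat_cvg (F : set_system {ptws nat -> nat}) (h : {ptws nat -> nat}) :
  Filter F -> (forall t, F [set g : {ptws nat -> nat} | g t = h t]) -> F --> h.
Proof.
move=> FF Fh; apply/cvg_sup => t V [B [[C oC <-] /= By] BV].
by apply: filterS (Fh t) => g gh; apply: BV; rewrite /preimage /= gh.
Qed.

(* [W t] is the radius of a window through which the residue of [k] modulo
   [n t] can be read off [shiftz k x]. *)
Definition recognizable (A : finPointedType) (x : fullshift A)
    (n W : nat -> nat) :=
  forall t (k l : int), agree (W t) (shiftz k x) (shiftz l x) ->
    (k = l %[mod n t])%Z.

(** By recognizability all admissible [k] have the same residue. The default 0 occurs only when no
    shift of [x] matches the window of [y], which is impossible on the orbit closure. *)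
Definition phase (A : finPointedType) (x : fullshift A) (n W : nat -> nat)
    (y : fullshift A) : {ptws nat -> nat} := fun t =>
  `|(xget 0 [set k : int | agree (W t) y (shiftz k x)] %% n t)%Z|%N.

Section phase.
Variables (A : finPointedType) (x : fullshift A) (n W : nat -> nat).
Hypotheses (xn : periodic_structure x n) (xW : recognizable x n W).
Implicit Types (y z : fullshift A) (M t : nat) (a k : int).
Local Notation K := (orbit_closure x).
Local Notation pi := (phase x n W).

Let n_gt0 t : (0 < n t)%N. Proof. by case: xn. Qed.
Let n_neq0 t : (n t)%:Z != 0. Proof. by rewrite eqz_nat -lt0n. Qed.

Lemma phaseE y t k : agree (W t) y (shiftz k x) ->
  (pi y t)%:Z = (k %% n t)%Z.
Proof.
move=> yk; rewrite /phase.
have kP : [set k : int | agree (W t) y (shiftz k x)] k by [].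
have := xgetPex 0 (ex_intro _ k kP); rewrite -/(xget _ _) /=.
move=> /agree_sym/agree_trans/(_ yk)/xW <-.
by rewrite gez0_abs// modz_ge0.
Qed.

(** One window large enough for all stages up to [t] gives a single [k]; this transfers arithmetic
    on shifts of [x] to arbitrary points of the orbit closure. *)
Lemma phase_approx y t M : K y ->
  exists k, agree M y (shiftz k x) /\
    forall s, (s <= t)%N -> (pi y s)%:Z = (k %% n s)%Z.
Proof.
move=> /orbit_closureP/(_ (M + \max_(i < t.+1) W i)%N)[k yk].
exists k; split; first by apply: agreeW yk; exact: leq_addr.
move=> s st; apply: phaseE; apply: agreeW yk.
apply: leq_trans (leq_addl _ _).
have st' : (s < t.+1)%N by [].
exact: (leq_bigmax (F := fun i : 'I_t.+1 => W i) (Ordinal st')).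
Qed.

Lemma phase_lt y t : (pi y t < n t)%N.
Proof.
rewrite /phase -ltz_nat gez0_abs ?modz_ge0//.
by apply: ltz_pmod; rewrite ltz_nat.
Qed.

Lemma phase_local t y z : agree (W t) y z -> pi y t = pi z t.
Proof.
move=> yz; rewrite /phase; congr (`|(xget _ _ %% _)%Z|%N).
apply/seteqP; split=> k /=; last exact: agree_trans yz.
by apply: agree_trans; exact: agree_sym.
Qed.

Lemma phase_base t : pi x t = 0%N.
Proof.
apply/eqP; rewrite -eqz_nat; apply/eqP.
rewrite (@phaseE x t 0) ?mod0z//.
by rewrite shiftz0; exact: agree_refl.
Qed.

Lemma phase_left_shift y t : K y ->
  pi (left_shift y) t = ((pi y t).+1 %% n t)%N.
Proof.
move=> Ky; have [k [yk /(_ t (leqnn _)) piy]] := phase_approx t (W t + 1) Ky.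
apply/eqP; rewrite -eqz_nat -modz_nat -addn1 PoszD piy; apply/eqP.
rewrite modzDml [k + _]addrC; apply: phaseE.
by rewrite -shiftzD left_shiftE; apply: agree_shiftz.
Qed.

Lemma phase_continuous (y : fullshift A) : {for y, continuous pi}.
Proof.
have := @ptws_nat_cvg (pi @ nbhs y) (pi y) _; apply=> t.
change (nbhs y [set z : fullshift A | pi z t = pi y t]).
by apply/nbhs_agree; exists (W t) => z /phase_local.
Qed.

Lemma odometer_dvdn (h : {ptws nat -> nat}) s t : odometer n h ->
  (s <= t)%N -> ((h t)%:Z = (h s)%:Z %[mod n s])%Z.
Proof.
move=> hn; rewrite !modz_nat; elim: t => [|t IH].
  by rewrite leqn0 => /eqP->.
rewrite leq_eqVlt => /orP[/eqP->//|/[!ltnS] st]; rewrite -IH//.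
have nst := periodic_structure_dvdn xn st.
by rewrite -(modn_dvdm _ nst); have [_ ->] := hn t; rewrite modn_dvdm.
Qed.

(** For surjectivity, shift [x] by the coordinates [h s] and take a cluster point: from stage [t]
    on, [h s] is congruent to [h t] modulo [n t]. *)
Lemma phase_image : pi @` K = odometer n.
Proof.
apply/seteqP; split=> [_ [y Ky <-] t|h hn].
  split; first exact: phase_lt.
  have [k [_ kn]] := phase_approx t.+1 0 Ky.
  apply/eqP; rewrite -eqz_nat -!modz_nat !kn// ?leqnSn//.
  by rewrite modz_mod modz_dvdn//; case: xn.
have [|y Ky yh] := @orbit_closure_cluster A x (fun s => shiftz (h s)%:Z x).
  by move=> s; exact: orbit_closure_shiftz.
exists y => //; apply/funext => t.
have [s ts ys] := yh (W t) t.
apply/eqP; rewrite -eqz_nat (phaseE ys) (odometer_dvdn hn ts).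
by rewrite modz_small//=; have [+ _] := hn t; lia.
Qed.

Lemma phase_factor_map : factor_map n K pi.
Proof.
split.
- by apply: continuous_subspaceT; exact: phase_continuous.
- exact: phase_image.
- by move=> y Ky; apply/funext => t; exact: phase_left_shift.
Qed.

(** Where the stage [t] has filled the window, the phase alone determines the block. The singleton
    fibre, the diameter bound and unique ergodicity all rest on this. *)
Lemma phase_agree y M t : K y ->
  (forall a, (`|a| <= M)%N -> Per x (n t) (a + (pi y t)%:Z)) ->
  agree M y (shiftz (pi y t)%:Z x).
Proof.
move=> Ky h; have [k [yk /(_ t (leqnn _)) kn]] := phase_approx t M Ky.
apply: agree_trans yk _; apply: Per_agree h _.
by rewrite kn modz_mod.
Qed.

(** The singleton fibre is that of 0, reached by [x]: each coordinate of [x] is filled at some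
    stage, and the zero phase at that stage fixes it. *)
Lemma phase_almost_1_1 : almost_1_1 n K pi.
Proof.
exists (fun=> 0%N); first by move=> t; split; [exact: n_gt0|].
exists x; apply/seteqP; split=> [y [Ky /= y0]|_ ->]; last first.
  split; first exact: orbit_closure_base.
  by apply/funext => t; exact: phase_base.
apply/funext => a; have [t tM] := Per_window xn `|a|.
have /(_ _ _ (leqnn _)) := @phase_agree y `|a| t Ky.
by rewrite y0 /shiftz addr0; apply=> b /tM; rewrite addr0.
Qed.

End phase.

(** * Periodic sets *)

Section periodic_sums.
Implicit Types (a b : int) (m L : nat).

Lemma sum_periodic (V : zmodType) (f : int -> V) m a :
  (forall b, f (b + m%:Z) = f b) ->
  \sum_(j < m) f (j%:Z + a) = \sum_(j < m) f j%:Z.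
Proof.
move=> fm.
have step b : \sum_(j < m) f (j%:Z + (b + 1)) = \sum_(j < m) f (j%:Z + b).
  (* A sum of [m.+1] consecutive terms is peeled at both ends; the two peeled terms are equal by
     periodicity and cancel. *)
  have e := @big_ord_recl V 0 +%R m (fun j => f ((j : nat)%:Z + b)).
  rewrite big_ord_recr /= [_%:Z + b]addrC fm add0r addrC in e.
  move/addrI: e => ->; apply: eq_bigr => i _; congr f.
  by rewrite /bump leq0n; lia.
elim/int_rec: a => [|a IH|a IH].
- by under eq_bigr do rewrite addr0.
- by rewrite -IH -(step a%:Z); apply: eq_bigr => j _; congr f; lia.
- by rewrite -(step (- a.+1%:Z)) -IH; apply: eq_bigr => j _; congr f; lia.
Qed.

Section density.
Variables (R : realType) (D : set int) (m : nat).
Hypotheses (m_gt0 : (0 < m)%N) (Dm : forall a, D (a + m%:Z) <-> D a).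

Let ind a : (\1_D a : R) = (a \in D)%:R. Proof. by rewrite indicE. Qed.

Let indD a : \1_D (a + m%:Z) = \1_D a :> R.
Proof.
by rewrite !ind; congr (nat_of_bool _)%:R; apply/idP/idP; rewrite !inE Dm.
Qed.

Let S : R := \sum_(j < m) \1_D j%:Z.

Let ind01 a : 0 <= (\1_D a : R) <= 1.
Proof. by rewrite ind; case: (_ \in _); rewrite ?lexx ?ler01. Qed.

Let sum01 L b : 0 <= \sum_(i < L) (\1_D (i%:Z + b) : R) <= L%:R.
Proof.
apply/andP; split; first by apply: sumr_ge0 => i _; case/andP: (ind01 (i%:Z + b)).
rewrite -[L%:R]mulr_natl mulr1 -[X in X%:R]card_ord -sumr_const.
by apply: ler_sum => i _; case/andP: (ind01 (i%:Z + b)).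
Qed.

(** Each full period contributes exactly [S]. In the remainder of length less than [m], both the
    count and its expected value lie between 0 and [m]. *)
Lemma periodic_count L b :
  `|\sum_(i < L) \1_D (i%:Z + b) - S / m%:R * L%:R| <= m%:R.
Proof.
have m0 : 0 < m%:R :> R by rewrite ltr0n.
have d01 : 0 <= S / m%:R <= 1.
  have := sum01 m 0; under eq_bigr do rewrite addr0.
  by move=> /andP[S0 Sm]; rewrite divr_ge0 ?ler_pdivrMr ?mul1r ?ler0n.
elim/ltn_ind: L b => L IH b; have [Lm|mL] := ltnP L m.
  have /andP[h1 h2] := sum01 L b.
  have Lm' : L%:R <= m%:R :> R by rewrite ler_nat ltnW.
  have L0 : 0 <= L%:R :> R by rewrite ler0n.
  rewrite ler_norml; apply/andP; split; nra.
rewrite -(subnKC mL) big_split_ord /= sum_periodic; last exact: indD.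
have L' : (L - m < L)%N by lia.
rewrite natrD mulrDr divfK ?gt_eqF// -/S opprD addrACA subrr add0r.
have := IH _ L' (b + m%:Z); congr (`|_ - _| <= _).
by apply: eq_bigr => i _; congr (\1_D _); lia.
Qed.

Lemma density_periodic : density R D = S / m%:R.
Proof.
apply: cvg_lim => //; apply/cvgrPdist_le => e e0.
near=> N; have N0 : 0 < N.*2.+1%:R :> R by rewrite ltr0n.
have -> : S / m%:R - (\sum_(i < N.*2.+1) \1_D (i%:Z - N%:Z)) / N.*2.+1%:R =
   - (\sum_(i < N.*2.+1) \1_D (i%:Z - N%:Z) - S / m%:R * N.*2.+1%:R)
     / N.*2.+1%:R.
  by field; rewrite ?gt_eqF ?ltr0n// addrC natr1.
rewrite normrM normrN normfV (gtr0_norm N0) ler_pdivrMr//.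
apply: le_trans (periodic_count _ _) _.
rewrite -ler_pdivrMl//; apply: (@le_trans _ _ N%:R).
  near: N; exact: nbhs_infty_ger.
by rewrite ler_nat; lia.
Unshelve. all: by end_near. Qed.

End density.
End periodic_sums.

Section bad_positions.
Variables (R : realType) (A : finPointedType) (x : fullshift A).
Implicit Types (m M : nat) (a : int).

Definition bad_ratio m : R := (\sum_(j < m) \1_(~` Per x m) j%:Z) / m%:R.

Definition bad_window m M : set int :=
  [set j | ~ forall a, (`|a| <= M)%N -> Per x m (a + j)].

Lemma Per_periodic m a : Per x m (a + m%:Z) <-> Per x m a.
Proof.
split=> /PerP h; apply/PerP => b e.
  rewrite (h b); last by rewrite modzDr.
  by rewrite -(h a)// modzDr.
by rewrite (h b) ?(h (a + m%:Z)) ?modzDr// e modzDr.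
Qed.

(** Union bound: a bad window contains an unfilled position at one of 2M+1 offsets, and by
    periodicity each offset gives the same count over a period. *)
Lemma sum_bad_window m M :
  \sum_(j < m) \1_(bad_window m M) j%:Z <=
    M.*2.+1%:R * \sum_(j < m) \1_(~` Per x m) j%:Z :> R.
Proof.
have CP a : \1_(~` Per x m) (a + m%:Z) = \1_(~` Per x m) a :> R.
  rewrite !indicE; congr (nat_of_bool _)%:R.
  by apply/idP/idP; rewrite !inE /= Per_periodic.
rewrite mulr_natl -[X in _ *+ X]card_ord -sumr_const.
under [leRHS]eq_bigr => i _.
  rewrite -(@sum_periodic _ (fun a => \1_(~` Per x m) a : R) _
              (i%:Z - M%:Z)) //. over.
rewrite exchange_big /=; apply: ler_sum => j _.
rewrite [leLHS]indicE; case: (boolP (_ \in _)) => [/set_mem|_]; last first.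
  by rewrite sumr_ge0.
move=> /existsNP[a /not_implyP[aM nP]].
have aM' : (`|(a + M%:Z)%R| < M.*2.+1)%N by lia.
rewrite (bigD1 (Ordinal aM')) //= -[leLHS]addr0 lerD ?sumr_ge0 //.
rewrite indicE mem_set //=; move: nP; congr (~ Per x m _); lia.
Qed.

End bad_positions.

(** * Diameters of the tower levels *)

Section diameters.
Variables (R : realType) (A : finPointedType).
Implicit Types (y z : fullshift A) (E : set (fullshift A)) (M : nat).

Lemma shift_dist_ge0 y z : 0 <= shift_dist R y z.
Proof. by rewrite /shift_dist; case: ifP => // _; exact: powR_ge0. Qed.

Lemma shift_dist_le M y z :
  (forall a : int, y a != z a -> (M <= `|a|)%N) -> shift_dist R y z <= 2^-1 ^+ M.
Proof.
move=> h; rewrite /shift_dist; case: ifPn => [_|yz].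
  by rewrite exprn_ge0 // invr_ge0.
have [a yza] : exists a, y a != z a.
  apply: contrapT => /forallNP e; move/eqP: yz; apply; apply/funext => a.
  by apply/eqP/negPn/negP/e.
rewrite exprVn -powR_mulrn// -powRN; apply: ler_powR; first by rewrite ler1n.
rewrite lerN2; apply: lb_le_inf; first by exists `|a|%:~R, a.
by move=> _ [b /= /h Mb <-]; rewrite -[M%:R]/(M%:Z%:~R) ler_int; lia.
Qed.

Lemma shift_dist_le1 y z : shift_dist R y z <= 1.
Proof. by rewrite -(expr0 (2^-1)); exact: shift_dist_le. Qed.

Lemma shift_dist_agree M y z : agree M y z -> shift_dist R y z <= 2^-1 ^+ M.
Proof.
move=> yz; apply: shift_dist_le => a; apply: contraNT; rewrite -ltnNge => aM.
by rewrite yz// ltnW.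
Qed.

Lemma diam_ge0 E : 0 <= diam R E.
Proof.
rewrite /diam; have [->|/set0P[y Ey]] := eqVneq E set0.
  by rewrite setX0 image_set0 sup0.
apply: (@le_trans _ _ (shift_dist R y y)); first exact: shift_dist_ge0.
apply: ub_le_sup; last by exists (y, y).
by exists 1 => _ [w _ <-]; exact: shift_dist_le1.
Qed.

Lemma diam_le E (c : R) : 0 <= c ->
  (forall y z, E y -> E z -> shift_dist R y z <= c) -> diam R E <= c.
Proof.
move=> c0 h; rewrite /diam; have [->|/set0P[y Ey]] := eqVneq E set0.
  by rewrite setX0 image_set0 sup0.
apply: ge_sup; first by exists (shift_dist R y y), (y, y).
by move=> _ [[v w] [/= Ev Ew] <-]; exact: h.
Qed.

End diameters.

Section towers.
Variables (R : realType) (A : finPointedType) (x : fullshift A).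
Variables (n W : nat -> nat).
Hypotheses (xn : periodic_structure x n) (xW : recognizable x n W).
Hypothesis bad0 : bad_ratio R x (n t) @[t --> \oo] --> (0 : R).
Implicit Types (M t : nat).
Local Notation K := (orbit_closure x).
Local Notation pi := (phase x n W).

Let n_gt0 t : (0 < n t)%N. Proof. by case: xn. Qed.

Lemma bad_window_ratio t M :
  (\sum_(j < n t) \1_(bad_window x (n t) M) j%:Z) / (n t)%:R <=
    M.*2.+1%:R * bad_ratio R x (n t).
Proof.
rewrite /bad_ratio mulrA ler_pM2r ?invr_gt0 ?ltr0n ?n_gt0//.
exact: sum_bad_window.
Qed.

Lemma phase_regular : regular_toeplitz R x n.
Proof.
rewrite /regular_toeplitz.
have -> : (fun t => density R (Per x (n t))) = (fun t => 1 - bad_ratio R x (n t)).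
  apply/funext => t; rewrite (@density_periodic R _ (n t))//; last exact: Per_periodic.
  rewrite /bad_ratio -[X in X - _](@divff _ (n t)%:R) ?pnatr_eq0 -?lt0n//.
  rewrite -mulrBl; congr (_ / _).
  rewrite -[X in X%:R - _]card_ord -sumr_const -sumrB.
  apply: eq_bigr => i _; rewrite !indicE in_setC.
  by case: (_ \in _); rewrite ?subr0 ?subrr.
by rewrite -[X in _ --> X]subr0; apply: cvgB => //; exact: cvg_cst.
Qed.

(** If the window of radius [M] at [j] is filled, all points of level [j] share that window and its
    diameter is at most 2^-M. The other levels are bounded by 1 and counted by [bad_window]. *)
Lemma tower_delta_le t M :
  tower_delta n R K pi t / (n t)%:R <=
    2^-1 ^+ M + M.*2.+1%:R * bad_ratio R x (n t).
Proof.
apply: le_trans (lerD (lexx _) (bad_window_ratio t M)).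
rewrite ler_pdivrMr ?ltr0n ?n_gt0// mulrDl divfK ?pnatr_eq0 -?lt0n ?n_gt0//.
rewrite mulr_natr -[X in _ *+ X]card_ord -sumr_const -big_split /=.
rewrite /tower_delta big_mkord; apply: ler_sum => j _.
rewrite indicE; case: (boolP (_ \in _)) => [_|/negP jM].
  apply: diam_le => [|y z _ _]; first by rewrite addr_ge0// exprn_ge0// invr_ge0.
  by apply: le_trans (shift_dist_le1 _ _ _) _; rewrite lerDr exprn_ge0// invr_ge0.
rewrite addr0; apply: diam_le => [|y z]; first by rewrite exprn_ge0// invr_ge0.
have {jM} jM a : (`|a| <= M)%N -> Per x (n t) (a + (j : nat)%:Z).
  move: a; apply: contrapT => nj; apply: jM; exact/mem_set.
move=> [Ky [_ yj]] [Kz [_ zj]]; apply: shift_dist_agree.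
have := phase_agree xn xW Ky; have := phase_agree xn xW Kz.
move=> /(_ M t); rewrite zj => /(_ jM) hz /(_ M t); rewrite yj => /(_ jM) hy.
exact: agree_trans hy (agree_sym hz).
Qed.

Lemma tower_delta_cvg :
  tower_delta n R K pi t / (n t)%:R @[t --> \oo] --> (0 : R).
Proof.
apply/cvgrPdist_le => e e0.
have e2 : 0 < e / 2 by rewrite divr_gt0.
(* The radius is fixed before [t] grows, so that the factor 2M+1 is a constant in the second
   term. *)
have [M Me] : exists M, 2^-1 ^+ M <= e / 2 :> R.
  have half1 : `|2^-1 : R| < 1 by rewrite gtr0_norm ?invf_lt1 ?invr_gt0 ?ltr1n.
  have /cvgrPdist_le/(_ _ e2)[M _ /(_ M (leqnn M))] :=
    cvg_expr half1.
  rewrite sub0r normrN => h; exists M; apply: le_trans h; exact: ler_norm.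
have bad0' : M.*2.+1%:R * bad_ratio R x (n t) @[t --> \oo] --> (0 : R).
  by rewrite -[X in _ --> X](mulr0 (M.*2.+1%:R : R)); exact: (cvgM (cvg_cst _) bad0).
near=> t; rewrite sub0r normrN ger0_norm; last first.
  by rewrite divr_ge0 ?ler0n//; apply: sumr_ge0 => j _; exact: diam_ge0.
apply: le_trans (tower_delta_le t M) _; rewrite [leRHS]splitr lerD//.
apply: le_trans (ler_norm _) _; rewrite -normrN -sub0r.
by near: t; move/cvgrPdist_le : bad0'; exact.
Unshelve. all: by end_near. Qed.

End towers.

(** * Window sets and Borel probabilities *)

Section window_sets.
Variable A : finPointedType.
Implicit Types (y z : fullshift A) (C : set (fullshift A)) (M : nat).

(** These are the clopen sets, that is the finite unions of cylinders. *)
Definition window_set C := exists M, forall y z, agree M y z -> C y -> C z.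

Lemma window_set0 : window_set set0. Proof. by exists 0%N. Qed.

Lemma window_setT : window_set setT. Proof. by exists 0%N. Qed.

Lemma window_setC C : window_set C -> window_set (~` C).
Proof.
by move=> [M CM]; exists M => y z /agree_sym yz Cy /(CM _ _ yz).
Qed.

Lemma window_setI C D : window_set C -> window_set D -> window_set (C `&` D).
Proof.
move=> [M CM] [N DN]; exists (maxn M N) => y z yz [Cy Dy]; split.
  by apply: CM Cy; apply: agreeW yz; exact: leq_maxl.
by apply: DN Dy; apply: agreeW yz; exact: leq_maxr.
Qed.

Lemma window_setU C D : window_set C -> window_set D -> window_set (C `|` D).
Proof.
by move=> wC wD; rewrite -[_ `|` _]setCK setCU; apply: window_setC;
  apply: window_setI; exact: window_setC.
Qed.

Lemma window_set_shift C k : window_set C -> window_set (shiftz k @^-1` C).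
Proof.
move=> [M CM]; exists (M + `|k|)%N => y z yz; apply: CM.
exact: agree_shiftz.
Qed.

Lemma window_set_open C : window_set C -> open C.
Proof.
move=> [M CM]; rewrite openE => y Cy; apply/nbhs_agree; exists M => z yz.
exact: CM yz Cy.
Qed.

Lemma window_set_compact C : window_set C -> compact C.
Proof.
move=> wC; apply: (subclosed_compact _ (@compact_fullshift A)) => //.
by rewrite -[C]setCK closedC; apply: window_set_open; exact: window_setC.
Qed.

Definition window_core (U : set (fullshift A)) M : set (fullshift A) :=
  [set y | forall z, agree M y z -> U z].

Lemma window_core_window_set U M : window_set (window_core U M).
Proof.
by exists M => y z yz yU w zw; apply: yU; exact: agree_trans yz zw.
Qed.

Lemma window_core_sub U M : window_core U M `<=` U.
Proof. by move=> y; apply; exact: agree_refl. Qed.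

Lemma open_window_core U : open U -> U = \bigcup_M window_core U M.
Proof.
rewrite openE => oU; apply/seteqP; split=> [y /oU /nbhs_agree[M yU]|y [M _]].
  by exists M.
exact: window_core_sub.
Qed.

(** A finite subfamily already covers the compact union, and disjointness empties all other members.
    Consequently a finitely additive content on window sets is automatically sigma-additive. *)
Lemma window_set_trivIset_fin (F : nat -> set (fullshift A)) :
  (forall i, window_set (F i)) -> trivIset setT F ->
  window_set (\bigcup_i F i) -> exists N, forall i, (N <= i)%N -> F i = set0.
Proof.
move=> wF tF /window_set_compact; rewrite compact_cover.
move=> /(_ _ [set: nat] F)[i _||D _ FD]; [exact: window_set_open|by []|].
exists (\max_(i <- finmap.enum_fset D) i).+1 => i Di.
apply: contrapT => /eqP/set0P[y Fy].
have [j /= jD Fjy] := FD y (ex_intro2 _ _ i Logic.I Fy).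
have ij := tF i j Logic.I Logic.I (ex_intro _ y (conj Fy Fjy)).
move: Di; rewrite ltnNge => /negP; apply.
by rewrite ij; exact: leq_bigmax_seq.
Qed.

Lemma borel_window_sets :
  <<s @open (fullshift A) >> = <<s window_set >>.
Proof.
apply/seteqP; split; apply: smallest_sub.
- exact: smallest_sigma_algebra.
- move=> U /open_window_core ->; apply: sigma_algebra_bigcup => M.
  by apply: sub_sigma_algebra; exact: window_core_window_set.
- exact: smallest_sigma_algebra.
- by move=> C wC; apply: sub_sigma_algebra; exact: window_set_open.
Qed.

End window_sets.

Lemma borel_probability_unique (R : realType) (A : finPointedType)
    (mu nu : {measure set (borel (fullshift A)) -> \bar R}) :
  (mu setT < +oo)%E ->
  (forall C, window_set C -> mu C = nu C) ->
  forall B : set (borel (fullshift A)), measurable B -> mu B = nu B.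
Proof.
move=> muT mn.
have := @measure_unique _ R (borel (fullshift A)) (@window_set A) (fun=> setT).
move=> /(_ _ _ _ _ mu nu); apply => //.
- exact: borel_window_sets.
- by move=> C D; exact: window_setI.
- by move=> _; exact: window_setT.
- by rewrite bigcup_const.
Qed.

Definition window_display (A : finPointedType) : measure_display.
Proof. exact: default_measure_display. Qed.

(** A copy of the full shift whose algebra of sets consists of the window sets, the domain from
    which a content is extended to a measure. *)
Definition window_space (A : finPointedType) : Type := fullshift A.

HB.instance Definition _ (A : finPointedType) := Pointed.on (window_space A).
HB.instance Definition _ (A : finPointedType) :=
  @isAlgebraOfSets.Build (window_display A) (window_space A) (@window_set A)
    (@window_set0 A) (@window_setU A) (@window_setC A).

(** * Existence of an invariant probability *)

Section window_content.
Variables (R : realType) (A : finPointedType) (m : set (fullshift A) -> R).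
Hypotheses (m_ge0 : forall C, 0 <= m C) (mT : m setT = 1).
Hypothesis mU : forall C D, C `&` D = set0 -> m (C `|` D) = m C + m D.

Let m0 : m set0 = 0.
Proof.
by have := @mU set0 set0 (set0I _); rewrite setU0 -[LHS]addr0 => /addrI <-.
Qed.

Definition window_premeasure (C : set (window_space A)) : \bar R := (m C)%:E.

Let premeasure0 : window_premeasure set0 = 0%E.
Proof. by rewrite /window_premeasure m0. Qed.

Let premeasure_ge0 C : (0 <= window_premeasure C)%E.
Proof. by rewrite lee_fin. Qed.

Let premeasure_sigma_additive : semi_sigma_additive window_premeasure.
Proof.
move=> F mF tF mbF.
have [N FN] := window_set_trivIset_fin mF tF mbF.
have part k : m (\bigcup_(i < k) F i) = \sum_(0 <= i < k) m (F i).
  elim: k => [|k IH]; first by rewrite big_geq// bigcup_mkord big_ord0.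
  rewrite big_nat_recr//= -IH -mU ?bigcup_mkord ?big_ord_recr//=.
  rewrite -bigcup_mkord; apply/seteqP; split => // y [[i /= ik Fi] Fk].
  have ik' := tF i k Logic.I Logic.I (ex_intro _ y (conj Fi Fk)).
  by rewrite ik' ltnn in ik.
apply: cvg_near_cst; exists N => // k /= Nk.
rewrite sumEFin -part /window_premeasure; congr (m _)%:E.
apply/seteqP; split=> [y [i _ Fi]|y [i _ Fi]]; first by exists i.
exists i => //=; rewrite ltnNge; apply/negP => ki.
by move: Fi; rewrite (FN i (leq_trans Nk ki)).
Qed.

HB.instance Definition _ := isMeasure.Build _ _ _ window_premeasure
  premeasure0 premeasure_ge0 premeasure_sigma_additive.

(** The extension is a measure on the sigma-algebra generated by the window sets;
    [borel_window_sets] allows the same set function to be read as a Borel measure. *)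
Definition window_extension (B : set (borel (fullshift A))) : \bar R :=
  measure_extension window_premeasure B.

Let extension0 : window_extension set0 = 0%E.
Proof. exact: (@measure0 _ _ _ (measure_extension window_premeasure)). Qed.

Let extension_ge0 B : (0 <= window_extension B)%E.
Proof. exact: (@measure_ge0 _ _ _ (measure_extension window_premeasure)). Qed.

Let extension_sigma_additive : semi_sigma_additive window_extension.
Proof.
have e (B : set (fullshift A)) : <<s @open (fullshift A) >> B ->
  <<s @window_set A >> B by rewrite borel_window_sets.
move=> F mF tF mbF.
apply: (@measure_semi_sigma_additive _ _ _
          (measure_extension window_premeasure)) => //.
- by move=> i; apply: e; exact: mF.
- by apply: e; exact: mbF.
Qed.

HB.instance Definition _ := isMeasure.Build _ _ _ window_extension
  extension0 extension_ge0 extension_sigma_additive.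

Lemma window_extensionE C : window_set C -> window_extension C = (m C)%:E.
Proof.
by move=> wC; rewrite /window_extension /measure_extension measurable_mu_extE.
Qed.

Let extensionT : window_extension setT = 1%E.
Proof. by rewrite window_extensionE ?mT//; exact: window_setT. Qed.

HB.instance Definition _ :=
  Measure_isProbability.Build _ _ _ window_extension extensionT.

Lemma borel_probability_exists : exists P : probability (borel (fullshift A)) R,
  forall C, window_set C -> P C = (m C)%:E.
Proof. exists window_extension => C; exact: window_extensionE. Qed.

End window_content.

Section ultrafilters.
Variable R : realType.

Lemma ultra_fmap (T V : Type) (f : T -> V) (U : set_system T) :
  UltraFilter U -> UltraFilter (f @ U).
Proof.
move=> UU; split; first exact: fmap_proper_filter.
move=> G GF UG; apply/seteqP; split=> // B GB.
have [//|UnB] := in_ultra_setVsetC (f @^-1` B) UU.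
have /UG/(filterI GB) : (f @ U) (~` B) by [].
by rewrite setICr => /filter_not_empty.
Qed.

(** An ultrafilter provides a generalized limit for all bounded sequences at once, so no subsequence
    has to be extracted for the frequencies of all sets. *)
Lemma ultra_cvg_bounded (U : set_system nat) (u : nat -> R) a b :
  UltraFilter U -> (forall N, a <= u N <= b) -> cvg (u @ U).
Proof.
move=> UU ub; have := @segment_compact R a b; rewrite compact_ultra.
move=> /(_ _ (ultra_fmap u UU))[|l [_ ul]]; last by apply/cvg_ex; exists l.
by apply: (@filterE _ U) => N; rewrite /preimage /= in_itv /=; exact: ub.
Qed.

End ultrafilters.

Section shift_measurability.
Variable A : finPointedType.

Definition borel_shift : borel (fullshift A) -> borel (fullshift A) :=
  @left_shift A.

Lemma measurable_borel_shift : measurable_fun setT borel_shift.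
Proof.
apply: (@measurability _ _ (borel (fullshift A)) (borel (fullshift A)) setT _
          (@window_set A)); first exact: borel_window_sets.
move=> _ [C wC <-]; rewrite setTI.
rewrite [X in X _](borel_window_sets A).
by apply: sub_sigma_algebra; exact: window_set_shift.
Qed.

Lemma window_set_measurable (C : set (borel (fullshift A))) :
  window_set C -> measurable C.
Proof.
move=> wC; rewrite [X in X _](borel_window_sets A).
exact: sub_sigma_algebra.
Qed.

Lemma measurable_orbit_closure (x : fullshift A) :
  measurable (orbit_closure x : set (borel (fullshift A))).
Proof.
rewrite -[orbit_closure x]setCK; apply: measurableC.
apply: sub_sigma_algebra; rewrite openC; exact: closed_orbit_closure.
Qed.

HB.instance Definition _ := isMeasurableFun.Build _ _ _ _ _ measurable_borel_shift.

Lemma invariant_on_window_sets (R : realType)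
    (P : probability (borel (fullshift A)) R) :
  (forall C, window_set C -> P (@left_shift A @^-1` C) = P C) ->
  forall B : set (borel (fullshift A)), measurable B ->
    P (@left_shift A @^-1` B) = P B.
Proof.
move=> PC B mB.
have muT : (distribution P borel_shift setT < +oo)%E.
  by rewrite probability_setT ltry.
exact: (@borel_probability_unique R A (distribution P borel_shift) P).
Qed.

End shift_measurability.

Section empirical.
Variables (R : realType) (A : finPointedType) (x : fullshift A).
Implicit Types C D : set (fullshift A).

Definition freq C (N : nat) : R :=
  (\sum_(k < N) \1_C (shiftz (k : nat)%:Z x)) / N%:R.

Lemma freq01 C N : 0 <= freq C N <= 1.
Proof.
rewrite /freq; case: N => [|N]; first by rewrite invr0 mulr0 lexx ler01.
have s0 : 0 <= \sum_(k < N.+1) (\1_C (shiftz (k : nat)%:Z x) : R).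
  by apply: sumr_ge0.
rewrite divr_ge0//= ler_pdivrMr ?ltr0n// mul1r.
rewrite -[leRHS]mulr_natl mulr1 -[X in X%:R]card_ord -sumr_const.
by apply: ler_sum => i _; rewrite indicE; case: (_ \in _).
Qed.

Lemma freqT N : freq setT N.+1 = 1.
Proof.
rewrite /freq (eq_bigr (fun=> 1)); last by move=> i _; rewrite indicT.
by rewrite sumr_const card_ord divff.
Qed.

Lemma freqU C D N : C `&` D = set0 -> freq (C `|` D) N = freq C N + freq D N.
Proof.
move=> CD; rewrite /freq -mulrDl -big_split /=; congr (_ / _).
apply: eq_bigr => k _; rewrite !indicE in_setU.
case: (boolP (_ \in C)) => kC; case: (boolP (_ \in D)) => kD /=;
  rewrite ?addr0 ?add0r//.
suff : set0 (shiftz k x) by [].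
by rewrite -CD; split; apply/set_mem.
Qed.

(** The two sums telescope: they differ only in one term at each end. *)
Lemma freq_left_shift C N :
  `|freq (@left_shift A @^-1` C) N - freq C N| <= N%:R^-1.
Proof.
rewrite /freq -mulrBl normrM [X in _ * X]ger0_norm ?invr_ge0//.
rewrite -[leRHS]mul1r ler_wpM2r ?invr_ge0//.
rewrite (eq_bigr (fun k : 'I_N => \1_C (shiftz (k.+1)%:Z x))); last first.
  move=> k _; rewrite !indicE; congr (nat_of_bool _)%:R.
  have e : left_shift (shiftz k x) = shiftz k.+1 x.
    by rewrite left_shiftE shiftzD; congr (shiftz _ _); lia.
  by apply/idP/idP; rewrite !inE /= e.
have e := @big_ord_recl R 0 +%R N (fun j => \1_C (shiftz (j : nat)%:Z x)).
rewrite big_ord_recr /= in e.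
set s1 := (X in `|X - _|); set s2 := (X in `|_ - X|).
have {}e : s2 + \1_C (shiftz N x) = \1_C (shiftz 0 x) + s1 by exact: e.
have -> : s1 - s2 = \1_C (shiftz N x) - \1_C (shiftz 0 x).
  by apply/eqP; rewrite subr_eq addrAC eq_sym subr_eq addrC e addrC.
by rewrite !indicE; case: (_ \in _); case: (_ \in _);
  rewrite ?subrr ?subr0 ?sub0r ?normrN ?normr0 ?normr1.
Qed.

(** Krylov-Bogolyubov argument: the limits of the frequencies along the orbit of [x], taken along an
    ultrafilter finer than [\oo], form an invariant content on window sets, which extends to a Borel
    probability. *)
Lemma invariant_probability_exists :
  exists P : probability (borel (fullshift A)) R,
    invariant_probability (orbit_closure x) (@left_shift A) P.
Proof.
have [U [UU ooU]] := @ultraFilterLemma nat (\oo) _.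
pose m C := lim (freq C @ U).
have fm C : freq C @ U --> m C by apply: ultra_cvg_bounded (freq01 C).
have U_cvg (u : nat -> R) (l : R) : u @ \oo --> l -> u @ U --> l.
  by move=> ul B /ul; exact: ooU.
have U_lim (u : nat -> R) (a b : R) : u @ U --> a -> u @ U --> b -> a = b.
  move=> ua ub; rewrite -[a](cvg_lim _ ua)//.
  by rewrite -[b](cvg_lim _ ub).
have m_ge0 C : 0 <= m C.
  apply: limr_ge; first by apply: ultra_cvg_bounded (freq01 C).
  by apply: filterE => N; case/andP: (freq01 C N).
have mT : m setT = 1.
  apply: U_lim (fm _) _; apply: U_cvg; apply: cvg_near_cst.
  by exists 1%N => // -[|N] //= _; exact: freqT.
have mU C D : C `&` D = set0 -> m (C `|` D) = m C + m D.
  move=> CD; apply: U_lim (fm _) _.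
  have -> : freq (C `|` D) = freq C \+ freq D.
    by apply/funext => N; exact: freqU.
  by apply: cvgD; exact: fm.
have mS C : m (@left_shift A @^-1` C) = m C.
  apply/eqP; rewrite -subr_eq0; apply/eqP.
  apply: (U_lim _ _ _ (cvgB (fm _) (fm _))); apply: U_cvg.
  apply/norm_cvg0P.
  apply: (@squeeze_cvgr _ _ _ _ (fun=> 0) (fun N => N%:R^-1)).
  - by apply: nearW => N; rewrite normr_ge0 freq_left_shift.
  - exact: cvg_cst.
  - by rewrite -(@cvg_shiftS R (fun N => N%:R^-1)); exact: cvg_harmonic.
have [P Pm] := borel_probability_exists m_ge0 mT mU.
exists P; split; last first.
  apply: invariant_on_window_sets => C wC.
  by rewrite !Pm ?mS//; exact: window_set_shift.
have oK : open (~` orbit_closure x).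
  by rewrite openC; exact: closed_orbit_closure.
have mK : measurable (~` orbit_closure x : set (borel (fullshift A))).
  exact: sub_sigma_algebra.
rewrite -[orbit_closure x]setCK probability_setC//.
suff -> : P (~` orbit_closure x) = 0%E by rewrite sube0.
apply: measure_negligible => //.
(* The open complement is a countable union of window sets; none of them contains a shift of [x], so
   all their frequencies vanish. *)
rewrite (open_window_core oK); apply: negligible_bigcup => M.
have wM := window_core_window_set (~` orbit_closure x) M.
apply/negligibleP; first exact: window_set_measurable.
suff : P (window_core (~` orbit_closure x) M) = 0%E by [].
rewrite Pm//; congr (_%:E); apply: U_lim (fm _) _.
rewrite (_ : freq _ = fun=> 0); first exact: cvg_cst.
apply/funext => N; rewrite /freq big1 ?mul0r// => k _.
rewrite indicE memNset// => /window_core_sub; apply.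
exact: orbit_closure_shiftz.
Qed.

End empirical.

(** * Unique ergodicity *)

Section unique_ergodicity.
Variables (R : realType) (A : finPointedType) (x : fullshift A).
Variables (n W : nat -> nat).
Hypotheses (xn : periodic_structure x n) (xW : recognizable x n W).
Hypothesis bad0 : bad_ratio R x (n t) @[t --> \oo] --> (0 : R).
Implicit Types (M t : nat) (C : set (fullshift A)).
Local Notation K := (orbit_closure x).
Local Notation pi := (phase x n W).

Let n_gt0 t : (0 < n t)%N. Proof. by case: xn. Qed.

Definition phase_level t j : set (fullshift A) := [set y | pi y t = j].

Lemma phase_level_window t j : window_set (phase_level t j).
Proof. by exists (W t) => y z /phase_local e; rewrite /phase_level /= e. Qed.

Section one_measure.
Variable P : probability (borel (fullshift A)) R.
Hypothesis PK : invariant_probability K (@left_shift A) P.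

Let p C : R := fine (P C).

Let PE C : window_set C -> P C = (p C)%:E.
Proof.
by move=> /window_set_measurable mC; rewrite fineK// fin_num_measure.
Qed.

(** The phase is equivariant only on the orbit closure, so identities between levels hold only on
    [K]; this carries them over to probabilities. *)
Lemma probability_on_closure C D : window_set C -> window_set D ->
  C `&` K = D `&` K -> P C = P D.
Proof.
suff h (B : set (borel (fullshift A))) : measurable B -> P B = P (B `&` K).
  move=> /window_set_measurable mC /window_set_measurable mD e.
  by rewrite (h C)// (h D)// e.
move=> mB; have mK := measurable_orbit_closure x.
have PK0 : P (~` K) = 0%E by rewrite probability_setC// PK.1 subee.
rewrite (measureDI P mB mK) (subset_measure0 _ _ _ PK0) ?add0e//.
- exact: measurableD.
- exact: measurableC.
Qed.

Lemma probability_phase_split t C : window_set C ->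
  fine (P C) = \sum_(j < n t) fine (P (C `&` phase_level t j)).
Proof.
move=> wC; pose F j : set (borel (fullshift A)) := C `&` phase_level t j.
have wF j : window_set (F j).
  by apply: window_setI => //; exact: phase_level_window.
have CF : C = \big[setU/set0]_(j < n t) F j.
  rewrite -bigcup_mkord; apply/seteqP; split=> [y Cy|y [j _ []]//].
  by exists (pi y t); [exact: (phase_lt _ xn)|split].
rewrite [in LHS]CF measure_bigsetU.
- rewrite -sum_fine//= => j _; rewrite fin_num_measure//.
  exact: window_set_measurable.
- by move=> j; exact: window_set_measurable.
- by move=> i j _ _ [y [[_ <-] [_ <-]]].
Qed.

(** On [K] the shift maps each level to the next one, so invariance makes the [n t] levels equally
    likely, and they partition the space. *)
Lemma phase_level_probability t j : (j < n t)%N ->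
  P (phase_level t j) = ((n t)%:R^-1)%:E.
Proof.
have wL i := phase_level_window t i.
have step i : (i.+1 < n t)%N -> P (phase_level t i.+1) = P (phase_level t i).
  move=> it; rewrite -(PK.2 _ (window_set_measurable (wL _))).
  apply: probability_on_closure => //.
    by rewrite left_shiftE; exact: window_set_shift.
  apply/seteqP; split=> y [/= yi Ky]; split => //; move: yi;
    rewrite /phase_level /= (phase_left_shift xn xW)//.
    have := phase_lt W xn y t.
    rewrite leq_eqVlt => /orP[/eqP ->|yt]; first by rewrite modnn.
    by rewrite modn_small// => -[].
  by move=> ->; rewrite modn_small.
have const i : (i < n t)%N -> P (phase_level t i) = P (phase_level t 0).
  by elim: i => // i IH it; rewrite step// IH// ltnW.
move=> jt; rewrite PE//; congr (_%:E).
have := @probability_phase_split t setT (@window_setT A).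
rewrite probability_setT (eq_bigr (fun=> p (phase_level t j))).
  rewrite sumr_const card_ord /= => e.
  have nt0 : (n t)%:R != 0 :> R by rewrite pnatr_eq0 -lt0n.
  by apply: (mulIf nt0); rewrite mulr_natr -e mulVf.
by move=> i _; rewrite setTI /p const// [in RHS]const.
Qed.

(** Outside [bad_window] all points of the level lying in [K] show the block of [shiftz j x], so the
    level is contained in [C] or misses it, up to a null set. The value does not depend on [P]. *)
Lemma probability_phase_level_good t M C j : (j < n t)%N ->
  (forall y z, agree M y z -> C y -> C z) -> ~ bad_window x (n t) M j%:Z ->
  P (C `&` phase_level t j) = (\1_C (shiftz j%:Z x) / (n t)%:R)%:E.
Proof.
move=> jt CM /contrapT good.
have wC : window_set C by exists M.
have wL := phase_level_window t j.
have yj y : K y -> phase_level t j y -> agree M y (shiftz j%:Z x).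
  move=> Ky yL; have := @phase_agree _ _ _ _ xn xW y M t Ky.
  by rewrite (yL : pi y t = j); exact.
rewrite indicE; case: (boolP (_ \in C)) => [/set_mem Cj|/negP Cj].
  rewrite mul1r -(phase_level_probability jt).
  apply: probability_on_closure => //; first exact: window_setI.
  apply/seteqP; split=> y [/=]; first by move=> [_ ?] ?; split.
  move=> yL Ky; split=> //; split=> //.
  by apply: CM Cj; apply: agree_sym; exact: yj.
rewrite mul0r; apply: etrans (measure0 P).
apply: probability_on_closure => //.
- exact: window_setI.
- exact: window_set0.
- apply/seteqP; split=> [y [[Cy yL] Ky]|y [[]]].
  exfalso; apply: Cj; apply/mem_set.
  by apply: CM Cy; exact: yj.
Qed.

Lemma probability_phase_level_le t C j : (j < n t)%N -> window_set C ->
  0 <= fine (P (C `&` phase_level t j)) <= (n t)%:R^-1.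
Proof.
move=> jt wC; have wL := phase_level_window t j.
rewrite fine_ge0//= -lee_fin -(phase_level_probability jt).
have mCL := window_set_measurable (window_setI wC wL).
rewrite fineK ?fin_num_measure//; apply: le_measure; rewrite ?inE//.
exact: window_set_measurable.
Qed.

End one_measure.

(** Split a window set along the levels: good levels cancel, and each bad one contributes at most
    1/[n t]. The total is the proportion of bad windows, which tends to 0. *)
Lemma invariant_probability_unique (P Q : probability (borel (fullshift A)) R) :
  invariant_probability K (@left_shift A) P ->
  invariant_probability K (@left_shift A) Q ->
  forall B : set (borel (fullshift A)), measurable B -> P B = Q B.
Proof.
move=> PK QK; have PT : (P setT < +oo)%E by rewrite probability_setT ltry.
apply: (borel_probability_unique PT).
move=> C wC; have mC := window_set_measurable wC.
rewrite -[LHS]fineK ?fin_num_measure// -[RHS]fineK ?fin_num_measure//.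
congr (_%:E); apply/eqP; rewrite -subr_eq0 -normr_le0.
have [M CM] := wC.
have le t : `|fine (P C) - fine (Q C)| <= M.*2.+1%:R * bad_ratio R x (n t).
  apply: le_trans (bad_window_ratio R xn t M).
  rewrite !(probability_phase_split _ t wC) -sumrB.
  apply: le_trans (ler_norm_sum _ _ _) _; rewrite mulr_suml.
  apply: ler_sum => j _; rewrite indicE.
  case: (boolP (_ \in _)) => [_|/negP jM]; last first.
    have {}jM : ~ bad_window x (n t) M j by move=> /mem_set.
    rewrite (probability_phase_level_good PK (ltn_ord j) CM jM).
    rewrite (probability_phase_level_good QK (ltn_ord j) CM jM).
    by rewrite subrr normr0 mul0r.
  have /andP[P0 P1] := probability_phase_level_le PK (ltn_ord j) wC.
  have /andP[Q0 Q1] := probability_phase_level_le QK (ltn_ord j) wC.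
  by rewrite mul1r ler_norml; apply/andP; split; lra.
have cv : M.*2.+1%:R * bad_ratio R x (n t) @[t --> \oo] --> (0 : R).
  by rewrite -[X in _ --> X](mulr0 (M.*2.+1%:R : R)); exact: (cvgM (cvg_cst _) bad0).
rewrite -(cvg_lim _ cv)//; apply: limr_ge; first by apply/cvg_ex; exists 0.
exact: nearW.
Qed.

Lemma toeplitz_strictly_ergodic : strictly_ergodic R K (@left_shift A).
Proof.
split; first exact: (orbit_closure_minimal xn).
have [P PK] := invariant_probability_exists R x.
exists P => // Q QK B mB; exact: invariant_probability_unique.
Qed.

End unique_ergodicity.

(** * Sieve sequences *)

Section sieve.
Variables (A : finPointedType) (q : nat -> nat) (r : nat -> int) (g : nat -> A).

Definition hit i (a : int) := (q i %| a - r i)%Z.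

Definition first_hit i a := hit i a /\ forall j, (j < i)%N -> ~~ hit j a.

(** Under [hit_all] every integer has a first hit, so the default index 0 never intervenes. *)
Definition sieve : fullshift A := fun a => g (xget 0%N [set i | first_hit i a]).

Definition sieve_period t := (\prod_(i < t) q i)%N.

Hypothesis q_gt1 : forall i, (1 < q i)%N.
Hypothesis q_coprime : forall i j, i != j -> coprime (q i) (q j).
Hypothesis hit_all : forall a, exists i, hit i a.
Hypothesis g_changes : forall i, exists2 j, (i < j)%N & g j != g i.

Implicit Types (a b k l : int) (i j s t : nat).
Local Notation x := sieve.
Local Notation n := sieve_period.

Lemma first_hitE i a : first_hit i a -> x a = g i.
Proof.
move=> [ia ai]; rewrite /sieve; congr g.
have /= := xgetPex 0%N (ex_intro [set i | first_hit i a] i (conj ia ai)).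
move: (xget _ _) => j [ja aj]; case: (ltngtP j i) => // [/ai|/aj].
  by rewrite ja.
by rewrite ia.
Qed.

Lemma hit_first i a : hit i a -> exists2 j, (j <= i)%N & first_hit j a.
Proof.
move=> ia; have ex : exists i, hit i a by exists i.
case: (ex_minnP ex) => j ja jmin; exists j; first exact: jmin.
by split=> // s; apply: contraTN => /jmin; rewrite -leqNgt.
Qed.

Lemma sieve_period_gt0 t : (0 < n t)%N.
Proof. by rewrite prodn_gt0// => i; exact: ltnW. Qed.

Lemma sieve_periodS t : n t.+1 = (n t * q t)%N.
Proof. by rewrite /sieve_period big_ord_recr. Qed.

Lemma dvdn_sieve_period i t : (i < t)%N -> (q i %| n t)%N.
Proof.
move=> it; rewrite /sieve_period (bigD1 (Ordinal it)) //=.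
exact: dvdn_mulr.
Qed.

Lemma coprime_sieve_period t i : (t <= i)%N -> coprime (n t) (q i).
Proof.
move=> ti; apply: (big_ind (fun m => coprime m (q i))) => [|a b ai bi|j _].
- exact: coprime1n.
- by rewrite coprimeMl ai bi.
- by apply: q_coprime; rewrite neq_ltn (leq_trans (ltn_ord j) ti).
Qed.

Lemma hit_mod i t a b : (i < t)%N -> (a = b %[mod n t])%Z -> hit i a = hit i b.
Proof.
move=> it /eqP; rewrite eqz_mod_dvd => ab.
have qab : (q i %| a - b)%Z.
  by apply: dvdz_trans ab; rewrite dvdzE; exact: dvdn_sieve_period.
by rewrite /hit -(subrK b a) -addrA rpredDl.
Qed.

Lemma first_hit_mod i t a b : (i < t)%N -> (a = b %[mod n t])%Z ->
  first_hit i a -> first_hit i b.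
Proof.
move=> it ab [ia ai]; split; first by rewrite -(hit_mod it ab).
by move=> j ji; rewrite -(hit_mod (ltn_trans ji it) ab) ai.
Qed.

(** The first hit of [a] has index at most [i], and hits of index below [t] depend only on the
    residue modulo [n t]. *)
Lemma sieve_Per i t a : (i < t)%N -> hit i a -> Per x (n t) a.
Proof.
move=> it /hit_first[j ji ja]; apply/PerP => b /esym ab.
rewrite (first_hitE ja); apply: first_hitE.
exact: first_hit_mod (leq_ltn_trans ji it) ab ja.
Qed.

Lemma sieve_periodic_structure : periodic_structure x n.
Proof.
split; first exact: sieve_period_gt0.
  by move=> t; rewrite sieve_periodS dvdn_mulr.
apply/seteqP; split=> // a _; have [i ia] := hit_all a.
by exists i.+1 => //; exact: sieve_Per ia.
Qed.

Lemma sieve_toeplitz : toeplitz x.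
Proof.
move=> a; have [i ia] := hit_all a; exists (n i.+1).
by split; [exact: sieve_period_gt0 | exact: (sieve_Per (ltnSn i) ia)].
Qed.

Lemma sieve_chinese (c : nat -> int) t :
  exists a, forall i, (i < t)%N -> (q i %| a - c i)%Z.
Proof.
elim: t => [|t [a ac]]; first by exists 0.
have co : coprimez (n t) (q t) by rewrite coprimezE coprime_sieve_period.
exists (zchinese (n t) (q t) a (c t)) => i; rewrite ltnS leq_eqVlt.
move=> /orP[/eqP ->|it].
  by rewrite -eqz_mod_dvd; apply/eqP; rewrite zchinese_modr.
rewrite -[_ - _](subrKA a) rpredD ?ac//.
have : (n t %| zchinese (n t) (q t) a (c t) - a)%Z.
  by rewrite -eqz_mod_dvd; apply/eqP; rewrite zchinese_modl.
by apply: dvdz_trans; rewrite dvdzE; exact: dvdn_sieve_period.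
Qed.

Lemma sieve_period_dvdz t a :
  (forall i, (i < t)%N -> (q i %| a)%Z) -> (n t %| a)%Z.
Proof.
elim: t => [|t IH] h; first by rewrite /sieve_period big_ord0 dvd1z.
rewrite sieve_periodS PoszM Gauss_dvdz ?coprimezE ?coprime_sieve_period//.
by rewrite IH ?h// => i it; apply: h; exact: ltnW.
Qed.

(** Since [q i] > 1, the residue [r i + 1] differs from [r i]; imposing it is the way to forbid a
    hit at index [i]. *)
Lemma hitN i a : (q i %| a - (r i + 1))%Z -> ~~ hit i a.
Proof.
apply: contraL => ia; rewrite opprD addrA rpredDl// dvdzE/=.
by rewrite dvdn1; have := q_gt1 i; lia.
Qed.

(* If [i] is least with [q i] not dividing [l - k], a single coordinate shows
   the letter [g i] after shifting by [k] and a different letter [g j] after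
   shifting by [l]. *)
Lemma sieve_recognizable : exists W, recognizable x n W.
Proof.
have [J JP] : exists J : nat -> nat, forall i, (i < J i)%N /\ g (J i) != g i.
  have /choice[J JP] : forall i, exists j, (i < j)%N /\ g j != g i.
    by move=> i; have [j ij gj] := g_changes i; exists j.
  by exists J.
pose T t := (\max_(i < t) J i).+1.
exists (fun t => n (T t)) => t k l kl.
apply/eqP; rewrite eqz_mod_dvd -opprB rpredN.
apply: sieve_period_dvdz => i; elim/ltn_ind: i => i IH it.
apply/negPn/negP => Nd; have [iJ gJ] := JP i; set d := l - k in IH Nd.
have JT : (J i < T t)%N.
  by rewrite ltnS; exact: (leq_bigmax (F := fun i : 'I_t => J i) (Ordinal it)).
(* The aim is that [b] is first hit at [i] and [b + d] at [J i]. Below [i], [q s] divides [d], so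
   one condition forbids both hits; at [i], [b] is hit and [b + d] is not because [q i] does not
   divide [d]; between [i] and [J i] the hit of [b + d] is forbidden, and at [J i] it is imposed. *)
have [b bc] := sieve_chinese (fun s => if (s < i)%N then r s + 1
  else if s == i then r i else if s == J i then r s - d else r s + 1 - d) (T t).
(* Every residue modulo [n (T t)] is met inside a window of that radius, which explains the choice
   of [W]. *)
pose a := ((b - k) %% n (T t))%Z.
have aW : (`|a| <= n (T t))%N.
  have nT := sieve_period_gt0 (T t).
  have : a < n (T t) by apply: ltz_pmod; exact: nT.
  have : 0 <= a by apply: modz_ge0; lia.
  lia.
have ak : (b = a + k %[mod n (T t)])%Z by rewrite modzDml subrK.
have al : (b + d = a + l %[mod n (T t)])%Z.
  by rewrite modzDml; congr (_ %% _)%Z; rewrite /d; lia.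
have := kl a aW; rewrite /shiftz.
have iT : (i < T t)%N by exact: ltn_trans JT.
rewrite (@first_hitE i); last first.
  apply: (first_hit_mod iT ak); split.
    by have := bc i iT; rewrite ltnn eqxx.
  move=> s si; apply: hitN.
  by have := bc s (ltn_trans si iT); rewrite si.
rewrite (@first_hitE (J i)); first by move=> e; rewrite e eqxx in gJ.
apply: (first_hit_mod JT al); split.
  have := bc _ JT; rewrite ltnNge (ltnW iJ) /= gtn_eqF// eqxx /hit.
  by congr (_ %| _)%Z; lia.
move=> s sJ; have := bc s (ltn_trans sJ JT).
case: ltngtP => [si|is_|->].
- move=> bs; apply: hitN; rewrite addrAC rpredD ?IH//.
  exact: ltn_trans si it.
- rewrite (ltn_eqF sJ) => bs; apply: hitN; move: bs; congr (_ %| _)%Z; lia.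
- move=> bi; apply/negP => ib; move/negP: Nd; apply; move: ib.
  by rewrite /hit addrAC rpredDl.
Qed.

(** Shift [x] by [h t] congruent to [r i] modulo [q i] for all [i] < [t]: then [a + h t] is hit at
    such an [i] exactly when [q i] divides [a]. A cluster point of these shifts keeps the property
    for all [i]. *)
Lemma sieve_limit_point : exists2 y : fullshift A, orbit_closure x y &
  forall i a, (q i %| a)%Z -> (forall j, (j < i)%N -> ~~ (q j %| a)%Z) ->
    y a = g i.
Proof.
have /choice[h hP] : forall t, exists a, forall i, (i < t)%N -> hit i a.
  by move=> t; exact: sieve_chinese.
have [|y Ky yh] := @orbit_closure_cluster A x (fun t => shiftz (h t) x).
  by move=> t; exact: orbit_closure_shiftz.
exists y => // i a ia ai; have [t it ->] := yh `|a|%N i.+1; last by [].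
have hitE j : (j <= i)%N -> hit j (a + h t) = (q j %| a)%Z.
  move=> ji; rewrite /hit -addrA rpredDr//.
  by apply: hP; exact: leq_ltn_trans it.
apply: first_hitE; split; first by rewrite hitE.
by move=> j ji; rewrite hitE ?ai// ltnW.
Qed.

End sieve.

Lemma sum_blocks (V : zmodType) (f : nat -> V) m k :
  \sum_(j < m * k) f j = \sum_(v < k) \sum_(u < m) f (u + m * v)%N.
Proof.
elim: k => [|k IH]; first by rewrite muln0 !big_ord0.
rewrite mulnS addnC big_split_ord big_ord_recr /= IH; congr (_ + _).
by apply: eq_bigr => u _; rewrite addnC.
Qed.

(** * Regularity of sieve sequences *)

Section sieve_density.
Variables (R : realType) (A : finPointedType).
Variables (q : nat -> nat) (r : nat -> int) (g : nat -> A).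
Hypothesis q_gt1 : forall i, (1 < q i)%N.
Hypothesis q_coprime : forall i j, i != j -> coprime (q i) (q j).
Implicit Types (a : int) (i j t u v : nat).
Local Notation x := (sieve q r g).
Local Notation n := (sieve_period q).
Local Notation hit := (hit q r).

Definition nohit t a := [forall i : 'I_t, ~~ hit i a].

Definition nohit_count t : R := \sum_(j < n t) (nohit t j%:Z)%:R.

Lemma nohitS t a : nohit t.+1 a = nohit t a && ~~ hit t a.
Proof.
apply/forallP/andP => [h|[/forallP h ht] i].
  split; last exact: (h ord_max).
  by apply/forallP => i; exact: (h (widen_ord (leqnSn t) i)).
have := ltn_ord i; rewrite ltnS leq_eqVlt => /orP[/eqP ->//|it].
exact: (h (Ordinal it)).
Qed.

Lemma nohit_mod t a b : (a = b %[mod n t])%Z -> nohit t a = nohit t b.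
Proof.
by move=> ab; apply: eq_forallb => i; rewrite (hit_mod r (ltn_ord i) ab).
Qed.

Lemma hit_class t u : (u < n t)%N ->
  exists2 v, (v < q t)%N & hit t (u + n t * v)%N%:Z.
Proof.
move=> ut; have nt := sieve_period_gt0 q_gt1 t.
have qt : (0 < q t)%N by exact: ltnW.
have co : coprimez (n t) (q t) by rewrite coprimezE (coprime_sieve_period q_coprime).
pose b := (zchinese (n t) (q t) u (r t) %% (n t * q t)%N)%Z.
have nq : (0 < n t * q t)%N by rewrite muln_gt0 nt.
have b0 : 0 <= b by apply: modz_ge0; rewrite eqz_nat -lt0n.
have bl : b < (n t * q t)%N by apply: ltz_pmod; rewrite ltz_nat.
have bu : (b = u%:Z %[mod n t])%Z.
  by rewrite modz_dvdn ?dvdn_mulr// zchinese_modl.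
have bq : (b = r t %[mod q t])%Z.
  by rewrite modz_dvdn ?dvdn_mull// zchinese_modr.
move: (b) b0 bl bu bq => -[c _|//]; rewrite ltz_nat => cl cu cq.
have {}cu : (c %% n t)%N = u.
  by move: cu; rewrite !modz_nat (modn_small ut) => -[].
exists (c %/ n t)%N; first by rewrite ltn_divLR// mulnC.
rewrite -cu mulnC addnC -divn_eq /hit -eqz_mod_dvd.
exact/eqP.
Qed.

(** Each residue modulo [n t] has [q t] lifts modulo [n t.+1], and by the Chinese remainder theorem
    one of them is hit at index [t]. *)
Lemma nohit_countS t : nohit_count t.+1 <= nohit_count t * ((q t)%:R - 1).
Proof.
rewrite /nohit_count sieve_periodS.
rewrite (sum_blocks (fun j => (nohit t.+1 j%:Z)%:R)) exchange_big /= mulr_suml.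
apply: ler_sum => u _.
have uv v : nohit t (u + n t * v)%N%:Z = nohit t (u : nat)%:Z.
  by apply: nohit_mod; rewrite PoszD PoszM addrC mulrC modzMDl.
under eq_bigr do rewrite nohitS uv -mulnb natrM.
rewrite -mulr_sumr; apply: ler_wpM2l; first exact: ler0n.
have [v vq hv] := hit_class (ltn_ord u).
rewrite (bigD1 (Ordinal vq)) //= hv add0r.
have -> : (q t)%:R - 1 = \sum_(i < q t | i != Ordinal vq) 1 :> R.
  rewrite -[X in X%:R](card_ord (q t)) -sumr_const (bigD1 (Ordinal vq))//=.
  by rewrite addrAC subrr add0r.
by apply: ler_sum => i _; case: (hit _ _).
Qed.

Lemma nohit_count_le t :
  nohit_count t / (n t)%:R <= \prod_(i < t) (1 - (q i)%:R^-1).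
Proof.
elim: t => [|t IH].
  rewrite big_ord0 /nohit_count /sieve_period big_ord0 divr1 big_ord1.
  by case: (nohit _ _).
have n0 : 0 < (n t)%:R :> R by rewrite ltr0n sieve_period_gt0.
have q0 : 0 < (q t)%:R :> R by rewrite ltr0n ltnW.
have q1 : 1 <= (q t)%:R :> R by rewrite ler1n ltnW.
rewrite big_ord_recr /= ler_pdivrMr; last by rewrite ltr0n sieve_period_gt0.
apply: le_trans (nohit_countS t) _.
rewrite sieve_periodS natrM -mulrA.
rewrite [X in _ <= _ * X](_ : _ = (n t)%:R * ((q t)%:R - 1)); last first.
  by rewrite mulrCA mulrBl mul1r mulVf ?gt_eqF.
by rewrite mulrA ler_wpM2r ?subr_ge0// -ler_pdivrMr.
Qed.

Lemma sieve_bad_ratio_le t :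
  bad_ratio R x (n t) <= \prod_(i < t) (1 - (q i)%:R^-1).
Proof.
apply: le_trans (nohit_count_le t); rewrite /bad_ratio.
rewrite ler_pM2r ?invr_gt0 ?ltr0n ?sieve_period_gt0//.
apply: ler_sum => j _; rewrite indicE; case: (boolP (_ \in _)) => // /set_mem h.
have -> : nohit t (j : nat)%:Z = true; last by [].
apply/forallP => i; apply/negP => ij.
by apply: h; exact: sieve_Per (ltn_ord i) ij.
Qed.

Lemma sieve_bad_ratio_cvg :
  (\prod_(i < t) (1 - (q i)%:R^-1) : R) @[t --> \oo] --> (0 : R) ->
  bad_ratio R x (n t) @[t --> \oo] --> (0 : R).
Proof.
move=> h; apply: squeeze_cvgr (cvg_cst 0) h; apply: nearW => t.
rewrite sieve_bad_ratio_le andbT /bad_ratio.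
by rewrite divr_ge0// sumr_ge0.
Qed.

End sieve_density.

(** * Divergence of the Euler product *)

Lemma next_prime_exists m : exists p, (m < p)%N && prime p.
Proof. by have [p mp pp] := prime_above m; exists p; rewrite mp pp. Qed.

Definition next_prime m := ex_minn (next_prime_exists m).

Lemma next_primeP m : [/\ (m < next_prime m)%N, prime (next_prime m) &
  forall p, prime p -> (m < p)%N -> (next_prime m <= p)%N].
Proof.
rewrite /next_prime; case: ex_minnP => p /andP[mp pp] pmin; split=> // s sp ms.
by apply: pmin; rewrite ms sp.
Qed.

Definition nth_prime i := iter i.+1 next_prime 0%N.

Lemma nth_primeS i : nth_prime i.+1 = next_prime (nth_prime i).
Proof. by []. Qed.

Lemma prime_nth_prime i : prime (nth_prime i).
Proof. by have [] := next_primeP (iter i next_prime 0%N). Qed.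

Lemma nth_prime_gt1 i : (1 < nth_prime i)%N.
Proof. exact/prime_gt1/prime_nth_prime. Qed.

Lemma nth_prime_ltS i : (nth_prime i < nth_prime i.+1)%N.
Proof. by have [] := next_primeP (nth_prime i). Qed.

Lemma nth_prime_lt i j : (i < j)%N -> (nth_prime i < nth_prime j)%N.
Proof. exact: (homo_ltn ltn_trans nth_prime_ltS). Qed.

Lemma nth_prime_id i : (i < nth_prime i)%N.
Proof.
elim: i => [|i IH]; first exact: ltnW (nth_prime_gt1 0).
exact: leq_ltn_trans IH (nth_prime_ltS i).
Qed.

Lemma coprime_nth_prime i j :
  i != j -> coprime (nth_prime i) (nth_prime j).
Proof.
move=> ij; rewrite prime_coprime ?prime_nth_prime//.
rewrite dvdn_prime2 ?prime_nth_prime//.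
by move: ij; rewrite neq_ltn => /orP[] /nth_prime_lt; rewrite neq_ltn => ->;
  rewrite ?orbT.
Qed.

Section euler_product.
Variable R : realType.
Implicit Types (t m N p : nat).

Definition smooth t m := all (fun p => (p < nth_prime t)%N) (primes m).

Definition smooth_inv t m : R := ((0 < m)%N && smooth t m)%:R * m%:R^-1.

Definition smooth_sum t N : R := \sum_(m < N) smooth_inv t m.

Lemma smooth_inv_ge0 t m : 0 <= smooth_inv t m.
Proof. by rewrite mulr_ge0// invr_ge0. Qed.

Lemma smoothS t m : (0 < m)%N -> ~~ (nth_prime t %| m)%N ->
  smooth t.+1 m -> smooth t m.
Proof.
move=> m0 Nqm /allP h; apply/allP => p pm; have := h p pm => pq.
have pp : prime p by move: pm; rewrite mem_primes => /and3P[].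
rewrite ltn_neqAle; apply/andP; split.
  by apply: contra Nqm => /eqP <-; move: pm; rewrite mem_primes => /and3P[].
rewrite leqNgt; apply/negP => qp.
have [_ _ /(_ _ pp qp)] := next_primeP (nth_prime t).
by rewrite -nth_primeS leqNgt pq.
Qed.

Lemma smooth_dvd t m d : (0 < m)%N -> (d %| m)%N -> smooth t m -> smooth t d.
Proof.
move=> m0 dm /allP h; apply/allP => p pd; apply: h; move: pd.
rewrite !mem_primes m0 => /and3P[-> _ pd]; exact: dvdn_trans dm.
Qed.

(* A [(t+1)]-smooth integer is either [t]-smooth or [nth_prime t] times
   a [(t+1)]-smooth integer. *)
Lemma smooth_sumS t N :
  smooth_sum t.+1 N <= smooth_sum t N + (nth_prime t)%:R^-1 * smooth_sum t.+1 N.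
Proof.
set q := nth_prime t; have q0 : (0 < q)%N by exact: ltnW (nth_prime_gt1 t).
pose H m : R := (q %| m)%N%:R * smooth_inv t.+1 m.
have H0 m : 0 <= H m by rewrite mulr_ge0// smooth_inv_ge0.
have split_le m : smooth_inv t.+1 m <= smooth_inv t m + H m.
  rewrite /H; case: (boolP (q %| m)%N) => qm.
    by rewrite mul1r lerDr smooth_inv_ge0.
  rewrite mul0r addr0 /smooth_inv ler_wpM2r ?invr_ge0// ler_nat.
  have [m0|] := posnP m; first by [].
  by move=> m0 /=; case: (boolP (smooth t.+1 m)) => //= /smoothS ->.
apply: (@le_trans _ _ (\sum_(m < N) (smooth_inv t m + H m))).
  by apply: ler_sum => m _; exact: split_le.
rewrite big_split /= lerD2l /smooth_sum mulr_sumr.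
(* The longer range is cut into [N] blocks of length [q]; in each block [H] keeps only the multiple
   of [q]. *)
apply: (@le_trans _ _ (\sum_(m < q * N) H m)).
  have NqN : (N <= q * N)%N by exact: leq_pmull.
  rewrite -(subnKC NqN) big_split_ord /= lerDl; apply: sumr_ge0 => i _.
  exact: H0.
rewrite sum_blocks; apply: ler_sum => v _.
rewrite (bigD1 (Ordinal q0)) //= big1 ?addr0 => [|u]; last first.
  rewrite -val_eqE /= => u0; rewrite /H dvdn_addl ?dvdn_mulr//.
  by rewrite gtnNdvd ?mul0r// lt0n.
rewrite /H add0n dvdn_mulr// mul1r /smooth_inv natrM invfM mulrCA.
rewrite ler_wpM2l ?invr_ge0// ler_wpM2r ?invr_ge0// ler_nat muln_gt0 q0 /=.
have [v0|v0] := posnP v; first by [].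
case: (boolP (smooth t.+1 (q * v))) => //= /smooth_dvd ->//.
  by rewrite muln_gt0 q0.
exact: dvdn_mull.
Qed.

Let euler t : R := \prod_(i < t) (1 - (nth_prime i)%:R^-1).

Let factor01 i : 0 <= 1 - (nth_prime i)%:R^-1 :> R /\ 1 - (nth_prime i)%:R^-1 <= 1 :> R.
Proof.
have h : 1 <= (nth_prime i)%:R :> R by rewrite ler1n ltnW// nth_prime_gt1.
by rewrite subr_ge0 invf_le1 ?(lt_le_trans ltr01)// h gerBl invr_ge0.
Qed.

Let euler_ge0 t : 0 <= euler t.
Proof. by apply: prodr_ge0 => i _; case: (factor01 i). Qed.

(** [smooth_sumS] says that the factor 1 - 1/q brings the sum at [t.+1] below the sum at [t], so the
    factors are absorbed one by one; at [t] = 0 the only smooth integer is 1. *)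
Lemma euler_smooth_sum t N : euler t * smooth_sum t N <= 1.
Proof.
elim: t => [|t IH].
  rewrite /euler big_ord0 mul1r /smooth_sum.
  have one m : smooth_inv 0 m = (m == 1%N)%:R.
    rewrite /smooth_inv; case: m => [|[|m]]; first by rewrite mul0r.
      by rewrite invr1 mulr1.
    have pm : pdiv m.+2 \in primes m.+2.
      by rewrite mem_primes pdiv_prime// pdiv_dvd.
    case: (boolP (smooth _ _)) => [/allP/(_ _ pm)|_]; last by rewrite mul0r.
    have [_ _ /(_ 2 isT isT) h] := next_primeP 0; move=> /leq_trans/(_ h).
    by rewrite ltnNge prime_gt1// pdiv_prime.
  under eq_bigr do rewrite one.
  case: N => [|[|N]]; first by rewrite big_ord0.
    by rewrite big_ord1.
  by rewrite 2!big_ord_recl/= add0r big1 ?addr0.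
apply: le_trans IH; rewrite /euler big_ord_recr /= -mulrA ler_wpM2l ?euler_ge0//.
by rewrite mulrBl mul1r lerBlDr; exact: smooth_sumS.
Qed.

(** The prime of index [N] exceeds [N], so every positive integer up to [N] is smooth. *)
Lemma smooth_sum_harmonic N : smooth_sum N N.+1 = series harmonic N.
Proof.
rewrite /smooth_sum big_ord_recl /smooth_inv /= mul0r add0r.
rewrite /series /= big_mkord; apply: eq_bigr => i _; rewrite /bump leq0n add1n.
rewrite (_ : smooth _ _ = true) ?mul1r//; apply/allP => p.
rewrite mem_primes => /and3P[_ _ /dvdn_leq]; move=> /(_ isT) pi.
by apply: leq_ltn_trans pi _; apply: leq_ltn_trans (ltn_ord i) (nth_prime_id N).
Qed.

Lemma harmonic_unbounded (B : R) : exists N, B < series harmonic N.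
Proof.
apply: contrapT => /forallNP h; apply: (@dvg_harmonic R).
apply: nondecreasing_is_cvgn.
  by apply: nondecreasing_series => i _ _; exact: harmonic_ge0.
exists B => _ [N _ <-]; rewrite leNgt; exact/negP/h.
Qed.

Lemma euler_nonincreasing t s : (s <= t)%N -> euler t <= euler s.
Proof.
elim: t => [|t IH]; first by rewrite leqn0 => /eqP ->.
rewrite leq_eqVlt => /orP[/eqP ->//|/IH]; apply: le_trans.
rewrite /euler big_ord_recr /=; have [_ h] := factor01 t.
by apply: ler_piMr => //; exact: euler_ge0.
Qed.

Lemma euler_product_cvg0 :
  \prod_(i < t) (1 - (nth_prime i)%:R^-1) @[t --> \oo] --> (0 : R).
Proof.
apply/cvgrPdist_le => e e0; have [N hN] := harmonic_unbounded e^-1.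
exists N => // t /= Nt; rewrite sub0r normrN ger0_norm ?euler_ge0//.
apply: le_trans (euler_nonincreasing Nt) _.
have := euler_smooth_sum N N.+1; rewrite smooth_sum_harmonic => h.
have H0 : 0 < series harmonic N :> R by apply: lt_trans hN; rewrite invr_gt0.
rewrite -ler_pdivlMr// in h; apply: le_trans h _.
by rewrite mul1r invf_ple// ltW.
Qed.

End euler_product.

(** * Failure of the prime number theorem *)

Lemma big_primes (I : Type) (idx : I) (op : Monoid.law idx) (F : nat -> I) m :
  \big[op/idx]_(0 <= p < nth_prime m | prime p) F p =
    \big[op/idx]_(i < m) F (nth_prime i).
Proof.
elim: m => [|m IH].
  rewrite big_ord0 big_nat_cond big_pred0// => p.
  apply/negP => /andP[/andP[_ p0] pp].
  have [_ _ /(_ _ pp (prime_gt0 pp))] := next_primeP 0.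
  by rewrite leqNgt p0.
rewrite (big_cat_nat _ (ltnW (nth_prime_ltS m)))//= IH big_ord_recr /=.
congr (op _ _); rewrite big_ltn_cond ?nth_prime_ltS// prime_nth_prime.
rewrite big_nat_cond big_pred0 ?Monoid.mulm1// => p.
apply/negP => /andP[/andP[mp pm] pp].
have [_ _ /(_ _ pp mp)] := next_primeP (nth_prime m).
by rewrite -nth_primeS leqNgt pm.
Qed.

(** [prime_count] includes its bound, whereas the averaged sum runs over p < N: at this N there are
    [m] terms over [m.+1], whence the denominators [(2 ^ k).+1] below. *)
Lemma prime_count_nth_prime m : prime_count (nth_prime m) = m.+1.
Proof.
rewrite /prime_count -(big_mkord prime (fun=> 1%N)).
rewrite big_mkcond big_nat_recr //= prime_nth_prime -big_mkcond big_primes.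
by rewrite sum_nat_const card_ord muln1 addn1.
Qed.

(* The letter of the [i]-th prime depends on the parity of the scale [k] with
   [2 ^ k <= i < 2 ^ k.+1], so the averages over the first [2 ^ k] primes
   oscillate. *)
Definition scale_parity i := odd (trunc_log 2 i).

Lemma scale_parity_changes i :
  exists2 j, (i < j)%N & scale_parity j != scale_parity i.
Proof.
(* An exponent at least [i] whose parity is opposite to [scale_parity i]; the number [2 ^ m] has
   scale [m]. *)
pose m := (i + (odd i == scale_parity i))%N.
exists (2 ^ m)%N; first by apply: leq_ltn_trans (ltn_expl m _) => //; exact: leq_addr.
rewrite {1}/scale_parity trunc_expnK// /m oddD.
by case: (odd i); case: (scale_parity i).
Qed.

Section oscillation.
Variable R : realType.

Definition parity_sum m : R := \sum_(i < m) (scale_parity i)%:R.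

Lemma parity_sum_double k :
  parity_sum (2 ^ k.+1) = parity_sum (2 ^ k) + (odd k)%:R * 2 ^+ k.
Proof.
rewrite /parity_sum expnS mul2n -addnn big_split_ord /=; congr (_ + _).
rewrite (eq_bigr (fun=> (odd k)%:R)) => [|i _].
  by rewrite sumr_const card_ord -natrX mulr_natr.
rewrite /scale_parity (@trunc_log_eq _ k)// expnS mul2n -addnn.
by rewrite leq_addr /= ltn_add2l.
Qed.

Lemma odd_not_cvg (l : R) : ~ (fun k : nat => (odd k)%:R : R) @ \oo --> l.
Proof.
move=> /cvgrPdist_lt/(_ 2^-1); rewrite invr_gt0 ltr0n => /(_ isT)[N _ h].
have N2 : (N <= N.*2)%N by rewrite -addnn leq_addr.
have := h _ N2; have := h _ (leqW N2).
rewrite /= odd_double /= subr0 !ltr_norml => /andP[h1 _] /andP[_ h2].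
lra.
Qed.

Lemma parity_average_not_cvg :
  ~ cvg ((fun k => parity_sum (2 ^ k) / (2 ^ k).+1%:R) @ \oo).
Proof.
move=> /cvg_ex[/= l vl]; pose v k := parity_sum (2 ^ k) / (2 ^ k).+1%:R.
have e0 : 2^-1 ^+ k @[k --> \oo] --> (0 : R).
  by apply: cvg_expr; rewrite gtr0_norm ?invf_lt1 ?invr_gt0 ?ltr1n.
have vSl : v k.+1 @[k --> \oo] --> l by rewrite cvg_shiftS.
apply: (@odd_not_cvg ((2 + 0) * l - (1 + 0) * l)).
(* The coefficients clear the denominators of the averages: the combination is the increment of
   [parity_sum] from 2^k to 2^(k+1) divided by 2^k, which is [odd k]. Convergence of the averages
   would make this sequence converge. *)
rewrite (_ : (fun k => _) =
   (fun k => (2 + 2^-1 ^+ k) * v k.+1 - (1 + 2^-1 ^+ k) * v k)).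
  apply: cvgB; apply: cvgM => //; apply: cvgD => //; exact: cvg_cst.
apply/funext => k; rewrite /v parity_sum_double exprVn.
have e1 : (2 ^ k).+1%:R = 2 ^+ k + 1 :> R by rewrite -natr1 natrX.
have e2 : (2 ^ k.+1).+1%:R = 2 * 2 ^+ k + 1 :> R by rewrite -natr1 natrX exprS.
have p0 : 0 < 2 ^+ k :> R by rewrite exprn_gt0.
rewrite e1 e2; move: (2 ^+ k) (parity_sum _) p0 => p s p0.
by field; rewrite !gt_eqF// ?addr_gt0// mulr_gt0.
Qed.

End oscillation.

HB.saturate bool.

Lemma coord0_continuous (R : realType) :
  continuous (fun y : fullshift bool => (y 0)%:R : R).
Proof.
move=> y; apply: cvg_near_cst.
by apply/nbhs_agree; exists 0%N => z yz; rewrite yz.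
Qed.

Lemma nth_prime_least_divisor (m : nat) j : (j < m)%N ->
  ~~ (nth_prime j %| (nth_prime m)%:Z)%Z.
Proof.
move=> jm; rewrite dvdzE /= dvdn_prime2 ?prime_nth_prime//.
by rewrite neq_ltn nth_prime_lt.
Qed.

Theorem theoremA (R : realType) :
  exists (A : finPointedType) (x : fullshift A) (n : nat -> nat)
         (pi : fullshift A -> {ptws nat -> nat}),
    [/\ toeplitz x, periodic_structure x n & regular_toeplitz R x n] /\
    [/\ factor_map n (orbit_closure x) pi,
        pi x = (fun=> 0%N),
        almost_1_1 n (orbit_closure x) pi &
        tower_delta n R (orbit_closure x) pi t / (n t)%:R @[t --> \oo] --> (0 : R)] /\
    strictly_ergodic R (orbit_closure x) (@left_shift A) /\
    ~ satisfies_PNT R (orbit_closure x) (@left_shift A).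
Proof.
(* The residues run through all integers: [a] is the residue of index [pickle a], so it is hit
   there, the difference being 0. *)
pose r i : int := odflt 0 (unpickle i).
have hit_all a : exists i, hit nth_prime r i a.
  by exists (pickle a); rewrite /hit /r pickleK subrr dvdz0.
pose x : fullshift bool := sieve nth_prime r scale_parity.
pose n := sieve_period nth_prime.
have xn : periodic_structure x n.
  exact: (sieve_periodic_structure scale_parity nth_prime_gt1 hit_all).
have [W xW] : exists W, recognizable x n W.
  exact: (sieve_recognizable r nth_prime_gt1 coprime_nth_prime scale_parity_changes).
have bad0 : bad_ratio R x (n t) @[t --> \oo] --> (0 : R).
  apply: (sieve_bad_ratio_cvg r scale_parity nth_prime_gt1 coprime_nth_prime).
  exact: euler_product_cvg0.
exists bool, x, n, (phase x n W); split; [split|split; [split|split]].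
- exact: (sieve_toeplitz scale_parity nth_prime_gt1 hit_all).
- exact: xn.
- exact: (phase_regular xn bad0).
- exact: phase_factor_map.
- by apply/funext => t; exact: phase_base.
- exact: phase_almost_1_1.
- exact: (tower_delta_cvg xn xW bad0).
- exact: (toeplitz_strictly_ergodic xn xW bad0).
have [y Ky yq] := sieve_limit_point r scale_parity coprime_nth_prime.
(* The test function reads coordinate 0, so its value after [p] shifts is the letter y(p). *)
move=> /(_ y (fun z : fullshift bool => (z 0)%:R) Ky).
move=> /(_ (continuous_subspaceT (@coord0_continuous R))) /cvg_ex[l ul].
apply: (@parity_average_not_cvg R); apply/cvg_ex; exists l.
(* Sampling the averages at the primes of index 2^k turns them into the divergent averages of
   [parity_sum]. *)
have ninf : nth_prime (2 ^ k) @[k --> \oo] --> \oo.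
  apply/cvgnyPge => N; near=> k; apply: leq_trans (ltnW (nth_prime_id _)).
  apply: leq_trans (ltnW (ltn_expl k _)) => //.
  by near: k; exact: nbhs_infty_ge.
apply: cvg_trans (cvg_comp _ _ ninf ul); apply: near_eq_cvg.
apply: nearW => k /=.
rewrite prime_count_nth_prime big_primes; congr (_ / _).
apply: eq_bigr => i _; rewrite iter_left_shift /shiftz add0r.
rewrite (yq i)// => j; exact: nth_prime_least_divisor.
Unshelve. all: by end_near. Qed.
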